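(* Let $G=G_0,G_1,\dots,G_r$ be the reduction series of a graph $G$ and let $0\le i<r$, so that $G_i$ is reduced to $G_{i+1}$. Let $\Phi_i:\mathrm{Aut}(G_i)\to\mathrm{Aut}(G_{i+1})$ be the reduction epimorphism. Then $$\mathrm{Aut}(G_{i+1})\cong \mathrm{Aut}(G_i)/\mathrm{Ker}(\Phi_i).$$
   Context: GRAPHS. A graph is a tuple $(D,V,\iota,\lambda)$ with $D$ a finite set of darts, $V$ a finite set of vertices, $\iota:D\to V$ a partial function (incidence) and $\lambda:D\to D$ an involution. Edges are the orbits $\{d,\lambda d\}$ of $\lambda$ of size 2, half-edges are the orbits of size 1. An edge is standard if $\iota(d),\iota(\lambda d)$ are defined and distinct, a loop if they are defined and equal, pendant if exactly one is defined, free if none is defined. A pendant edge at $v$ is single if it is the only pendant edge attached to $v$. Edges are colored and have one of three types: halvable, undirected, directed (the latter with an orientation); pendant edges are undirected. The graph $G$ is connected, without loops and half-edges. When vertices are removed, their incident edges are kept as pendant or free edges; a free edge is a connected component. Automorphisms and isomorphisms are bijections on vertices and darts that commute with $\iota$ and $\lambda$ and preserve colors, types and orientations of edges; $\mathrm{Aut}(G)$ is the automorphism group. SEMIREGULARITY. A group of automorphisms is semiregular if stabilizers of all vertices, darts and non-halvable edges are trivial; a halvable edge may be fixed by an involution interchanging its two darts. An automorphism $\pi$ is semiregular if $\langle\pi\rangle$ is. BLOCK-TREE. An articulation is a vertex $u$ with $G\setminus u$ disconnected. Blocks are the maximal 2-connected subgraphs, where bridge-edges and pendant edges also count as blocks.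 The block-tree is the incidence graph between articulations and blocks; its center is a single vertex, called the central articulation or the central block ($K_1$, possibly with one pendant edge, is regarded as having a central articulation). The tree is rooted at its center; the rooted subtree determined by a node $x$ consists of $x$ and all nodes whose path to the center passes through $x$. ATOMS. For a subgraph $A$, $\partial A$ is the set of vertices of $A$ incident with an edge not in $A$, and $\mathring A=A\setminus\partial A$. Parts are the following subgraphs. Block part: the union $S$ of all blocks in the rooted subtree determined by a node other than the central block, where $S$ is not a single pendant edge. Proper part: given a block $B$ and a 2-cut $U=\{u,v\}$ of $B$ (i.e. $B\setminus U$ has at least two connected components containing vertices) with $u,v$ of degree at least 3 in $B$, the subgraph consisting of $u,v$ and a connected component $K$ of $G\setminus U$ that contains a component of $B\setminus U$ (with the edges joining $K$ to $U$), where $K$ is not a single free edge and $K$ does not contain all vertices of the central block or the central articulation. Dipole part (dipole): two vertices with all edges joining them, there being at least two such edges. Atoms are the inclusion-minimal parts: block atoms, proper atoms, dipoles. The boundary $\partial A$ is: the articulation at which $A$ is attached for a block atom (the center, for a star of pendant edges); $U$ for a proper atom; the two vertices for a dipole. A graph is primitive if it has no atoms. SYMMETRY TYPES. $\mathrm{Aut}_{\partial A}(A)$ is the set-wise stabilizer of $\partial A$ in $\mathrm{Aut}(A)$. A proper atom or dipole $A$ with $\partial A=\{u,v\}$ is halvable if some semiregular involution in $\mathrm{Aut}_{\partial A}(A)$ exchanges $u,v$; symmetric if it is not halvable but some element of $\mathrm{Aut}_{\partial A}(A)$ exchanges $u,v$; asymmetric otherwise. A $\partial$-isomorphism $A\to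 A'$ is an isomorphism mapping $\partial A$ onto $\partial A'$. REDUCTION. $G_{i+1}$ arises from $G_i$ by replacing simultaneously the interior of every atom $A$ of $G_i$ by an edge $e_A$, with a new color for each $\partial$-isomorphism class of atoms: a pendant edge at $u$ if $A$ is a block atom with $\partial A=\{u\}$; a halvable/undirected/directed edge $uv$ if $A$ is a halvable/symmetric/asymmetric proper atom or dipole with $\partial A=\{u,v\}$, directed edges being oriented consistently with $\partial$-isomorphisms inside each class. Atoms in all steps are taken with respect to the image of the central block/articulation of $G$. The reduction series $G=G_0,\dots,G_r$ stops when $G_r$ is primitive. REDUCTION EPIMORPHISM. For $\pi\in\mathrm{Aut}(G_i)$, $\Phi_i(\pi)$ acts as $\pi$ on common vertices, edges and darts of $G_i$ and $G_{i+1}$, and maps $e_A$ to $e_{\pi(A)}$ for each atom $A$ of $G_i$; the dart of $e_A$ at $u\in\partial A$ is mapped to the dart of $e_{\pi(A)}$ at $\pi(u)$, and the other dart to the other dart. *)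

(* Defs.v *)
From HB Require Import structures.
From mathcomp Require Import all_boot all_fingroup.

Set Implicit Arguments.
Unset Strict Implicit.
Unset Printing Implicit Defensive.

(* -------------------------------------------------------------------------- *)
(* Graphs                                                                     *)
(* -------------------------------------------------------------------------- *)

Inductive edge_type := Halvable | Undirected | Directed.

Definition edge_type_code (t : edge_type) : option bool :=
  match t with Halvable => None | Undirected => Some false | Directed => Some true end.

Definition edge_type_decode (o : option bool) : edge_type :=
  match o with None => Halvable | Some false => Undirected | Some true => Directed end.

Lemma edge_type_codeK : cancel edge_type_code edge_type_decode.
Proof. by case. Qed.

HB.instance Definition _ := Equality.copy edge_type (can_type edge_type_codeK).

(* Colors and types are attached to edges, hence constant on the orbits of the
   involution; a directed edge is oriented by marking exactly one of its two
   darts ([pos] is meaningless on the other edges). *)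
Record graph := Graph {
  vert : finType;
  dart : finType;
  inc : dart -> option vert;
  inv : dart -> dart;
  color : dart -> nat;
  kind : dart -> edge_type;
  pos : dart -> bool;
  invK : involutive inv;
  color_inv : forall d, color (inv d) = color d;
  kind_inv : forall d, kind (inv d) = kind d;
  pos_inv : forall d, kind d = Directed -> pos (inv d) = ~~ pos d
}.

Section GraphNotions.

Variable G : graph.
Local Notation V := (vert G).
Local Notation D := (dart G).

Definition half_edge_free := forall d : D, inv d != d.

Definition loop_free :=
  forall (d : D) (v : V), inv d != d -> inc d = Some v -> inc (inv d) <> Some v.

Definition pendant (d : D) := (inc d == None) != (inc (inv d) == None).

(* A vertex set and a dart set.  The incidence of a subgraph is the restriction
   of [inc] to its vertices, so an edge whose end-vertex was removed becomes
   pendant or free. *)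
Definition subgraph := ({set V} * {set D})%type.

Definition whole : subgraph := (setT, setT).

Definition sub_le (A B : subgraph) := (A.1 \subset B.1) && (A.2 \subset B.2).

Definition remove (A : subgraph) (U : {set V}) : subgraph := (A.1 :\: U, A.2).

Definition in_sub (A : subgraph) (x : V + D) :=
  match x with inl v => v \in A.1 | inr d => d \in A.2 end.

Definition touch (x y : V + D) :=
  match x, y with
  | inl v, inr d | inr d, inl v => inc d == Some v
  | inr d, inr d' => inv d == d'
  | inl _, inl _ => false
  end.

Definition linked (A : subgraph) : rel (V + D) :=
  connect [rel x y | [&& in_sub A x, in_sub A y & touch x y]].

Definition connected (A : subgraph) :=
  [forall x, forall y, in_sub A x ==> in_sub A y ==> linked A x y].

Definition component_of (A : subgraph) (x : V + D) : subgraph :=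
  ([set v in A.1 | linked A x (inl v)], [set d in A.2 | linked A x (inr d)]).

Definition component (A K : subgraph) :=
  [exists x, in_sub A x && (K == component_of A x)].

(* -------------------------------------------------------------------------- *)
(* Blocks and the block-tree                                                  *)
(* -------------------------------------------------------------------------- *)

Definition articulation (A : subgraph) (u : V) :=
  (u \in A.1) && ~~ connected (remove A [set u]).

Definition closed_sub (A : subgraph) :=
  [forall d in A.2, (inv d \in A.2) && (if inc d is Some v then v \in A.1 else true)].

(* Connected, without articulations and with at least one edge.  This includes
   a single edge with both its end-vertices and a pendant edge with its
   end-vertex, so that bridge-edges and pendant edges are blocks. *)
Definition two_connected (A : subgraph) :=
  [&& closed_sub A, A.2 != set0, connected A & [forall u, ~~ articulation A u]].

Definition block (B : subgraph) :=
  two_connected B && [forall B', two_connected B' ==> sub_le B B' ==> (B' == B)].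

(* [inl u] is an articulation, [inr B] a block. *)
Definition node := (V + subgraph)%type.

Definition bt_node (x : node) :=
  match x with inl u => articulation whole u | inr B => block B end.

Definition bt_adj : rel node := fun x y =>
  [&& bt_node x, bt_node y &
    match x, y with
    | inl u, inr B | inr B, inl u => u \in B.1
    | _, _ => false
    end].

Definition bt_dist_le (x y : node) (n : nat) :=
  exists p, [/\ path bt_adj x p, last x p = y & size p <= n].

Definition bt_ecc_le (x : node) (n : nat) :=
  forall y, bt_node y -> bt_dist_le x y n.

(* The first case is the convention for K_1, possibly with one pendant edge:
   its vertex is the central articulation. *)
Definition is_center (c : node) :=
  if (#|V| == 1) && (#|D| <= 2) then exists v, c = inl v
  else bt_node c /\
    forall x n, bt_node x -> bt_ecc_le x n -> bt_ecc_le c n.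

(* -------------------------------------------------------------------------- *)
(* Parts and atoms, for a block-tree rooted at c                              *)
(* -------------------------------------------------------------------------- *)

Variable c : node.

Definition in_subtree (x y : node) :=
  forall p, path bt_adj y p -> last y p = c -> x \in y :: p.

Definition is_pendant_edge (A : subgraph) :=
  exists2 d, pendant d & A.2 = [set d; inv d].

(* For a block node the subtree is attached at its parent articulation, for an
   articulation node at this articulation. *)
Definition attached_at (x : node) (u : V) :=
  match x with
  | inl w => u = w
  | inr B => bt_adj (inl u) x /\ in_subtree (inl u) x
  end.

Definition block_part (A : subgraph) (u : V) :=
  exists x : node,
    [/\ bt_node x,
        (forall B, x = inr B -> x <> c),
        (forall v, v \in A.1 <->
           exists B, [/\ block B, in_subtree x (inr B) & v \in B.1]) &
        (forall d, d \in A.2 <->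
           exists B, [/\ block B, in_subtree x (inr B) & d \in B.2])]
    /\ ~ is_pendant_edge A /\ attached_at x u.

Definition degree_in (B : subgraph) (u : V) := #|[set d in B.2 | inc d == Some u]|.

Definition two_cut (B : subgraph) (u v : V) :=
  [/\ u != v, u \in B.1, v \in B.1 &
    exists x y : V,
      [/\ x \in B.1 :\: [set u; v], y \in B.1 :\: [set u; v] &
          ~~ linked (remove B [set u; v]) (inl x) (inl y)]].

Definition misses_center (K : subgraph) :=
  match c with inl w => w \notin K.1 | inr C => ~~ (C.1 \subset K.1) end.

Definition is_free_edge (K : subgraph) :=
  exists d, K = (set0, [set d; inv d]).

(* Removing u and v keeps the edges joining K to them, so these edges are
   already in K. *)
Definition proper_part (A : subgraph) (u v : V) :=
  exists B K J : subgraph,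
    [/\ block B, two_cut B u v, 3 <= degree_in B u & 3 <= degree_in B v] /\
    [/\ component (remove whole [set u; v]) K,
        component (remove B [set u; v]) J, sub_le J K,
        ~ is_free_edge K & misses_center K] /\
    A = (u |: (v |: K.1), K.2).

(* The darts at u of the edges joining u and v: one for each such edge. *)
Definition joining (u v : V) :=
  [set d : D | (inc d == Some u) && (inc (inv d) == Some v)].

Definition dipole_part (A : subgraph) (u v : V) :=
  [/\ u != v, 2 <= #|joining u v| & A = ([set u; v], joining u v :|: joining v u)].

Definition part (A : subgraph) :=
  [\/ exists u, block_part A u,
      exists u v, proper_part A u v |
      exists u v, dipole_part A u v].

Definition atom (A : subgraph) :=
  part A /\ forall A', part A' -> sub_le A' A -> A' = A.

Definition primitive := forall A, ~ atom A.

(* A dipole which happens to be a leaf block is also an inclusion-minimal block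
   part; it is counted as a dipole only. *)
Definition block_atom (A : subgraph) (u : V) :=
  [/\ atom A, block_part A u & ~ exists v w, dipole_part A v w].

Definition two_atom (A : subgraph) (u v : V) :=
  atom A /\ (proper_part A u v \/ dipole_part A u v).

Definition boundary (A : subgraph) (U : {set V}) :=
  (exists2 u, block_atom A u & U = [set u]) \/
  (exists u v, two_atom A u v /\ U = [set u; v]).

(* The interior of an atom: the vertices off the boundary and all the edges. *)
Definition interior_vert (v : V) := exists A U, boundary A U /\ v \in A.1 :\: U.
Definition interior_dart (d : D) := exists A, atom A /\ d \in A.2.

(* -------------------------------------------------------------------------- *)
(* Isomorphisms, automorphism groups and symmetry types                       *)
(* -------------------------------------------------------------------------- *)

Definition preserves (f : V -> V) (g : D -> D) (d : D) :=
  [&& inc (g d) == omap f (inc d), inv (g d) == g (inv d),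
      color (g d) == color d, kind (g d) == kind d &
      (kind d == Directed) ==> (pos (g d) == pos d)].

(* Only the values of f on A.1 and of g on A.2 matter. *)
Definition sub_iso (A B : subgraph) (f : V -> V) (g : D -> D) :=
  [/\ {in A.1 &, injective f}, {in A.2 &, injective g},
      f @: A.1 = B.1, g @: A.2 = B.2 & {in A.2, forall d, preserves f g d}].

Definition boundary_iso (A B : subgraph) (f : V -> V) (g : D -> D) :=
  sub_iso A B f g /\
  exists U W, [/\ boundary A U, boundary B W & f @: U = W].

(* An automorphism of A is represented by the permutations of V and D which
   extend it by the identity. *)
Definition aut_set (A : subgraph) : {set {perm V} * {perm D}} :=
  [set p | [&& perm_on A.1 p.1, perm_on A.2 p.2 &
               [forall d in A.2, preserves p.1 p.2 d]]].

Lemma aut_group_set A : group_set (aut_set A).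
Proof.
apply/group_setP; split.
  rewrite inE /= !perm_on1; apply/forall_inP => d _.
  rewrite /preserves !perm1 !eqxx implybT !andbT /=.
  by case: (inc d) => //= v; rewrite perm1.
move=> p q; rewrite !inE => /and3P[p1 p2 /forall_inP hp] /and3P[q1 q2 /forall_inP hq].
rewrite /= !perm_onM //; apply/forall_inP => d dA.
have /and5P[/eqP a1 /eqP a2 /eqP a3 /eqP a4 /implyP a5] := hp d dA.
have pdA : p.2 d \in A.2 by rewrite perm_closed.
have /and5P[/eqP b1 /eqP b2 /eqP b3 /eqP b4 /implyP b5] := hq _ pdA.
rewrite /preserves !permM b1 a1 b2 a2 b3 a3 b4 a4 !eqxx /= andbC; apply/andP; split.
  apply/implyP => k; rewrite (eqP (b5 _)) ?a4 //; exact: a5.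
by case: (inc d) => //= v; rewrite permM.
Qed.

Canonical aut_group A := Group (aut_group_set A).

Definition aut_boundary (A : subgraph) (U : {set V}) :=
  [set p in aut_set A | p.1 @: U == U].

Definition semiregular (A : subgraph) (H : {set {perm V} * {perm D}}) :=
  forall p, p \in H ->
    [\/ exists2 v, v \in A.1 & p.1 v = v,
        exists2 d, d \in A.2 & p.2 d = d |
        exists2 d, d \in A.2 & kind d <> Halvable /\ p.2 d \in [set d; inv d]] ->
    p = 1%g.

Definition exchanges (p : {perm V} * {perm D}) (u v : V) := p.1 u = v /\ p.1 v = u.

Definition halvable_boundary (A : subgraph) (u v : V) :=
  exists2 p, p \in aut_boundary A [set u; v] &
    [/\ #[p]%g = 2, semiregular A <[p]>%g & exchanges p u v].

Definition exchangeable_boundary (A : subgraph) (u v : V) :=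
  exists2 p, p \in aut_boundary A [set u; v] & exchanges p u v.

(* The type of the edge replacing the atom A. *)
Definition replacing_type (A : subgraph) (t : edge_type) :=
  match t with
  | Halvable => exists u v, two_atom A u v /\ halvable_boundary A u v
  | Undirected =>
      (exists u, block_atom A u) \/
      exists u v, [/\ two_atom A u v, ~ halvable_boundary A u v &
                      exchangeable_boundary A u v]
  | Directed =>
      exists u v, [/\ two_atom A u v, ~ halvable_boundary A u v &
                      ~ exchangeable_boundary A u v]
  end.

End GraphNotions.

Definition AutG (G : graph) := aut_group (whole G).

(* -------------------------------------------------------------------------- *)
(* Reduction                                                                  *)
(* -------------------------------------------------------------------------- *)

(* The root is the image of the central articulation or block of the graph at
   the beginning of the reduction series. *)
Record rooted_graph := Rooted { rgraph :> graph; root : node rgraph }.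

(* Where a dart of the reduced graph comes from: [inl d] is a dart d common to
   both graphs, [inr (A, Some u)] is the dart of e_A at u, and [inr (A, None)]
   is the other dart of e_A when e_A is pendant. *)
Definition origin (G : graph) := (dart G + subgraph G * option (vert G))%type.

Definition valid_origin (G : rooted_graph) (x : origin G) :=
  match x with
  | inl d => ~ interior_dart (root G) d
  | inr (A, Some u) => exists2 U, boundary (root G) A U & u \in U
  | inr (A, None) => exists u, block_atom (root G) A u
  end.

(* G' arises from G by replacing the interiors of all its atoms: [rv] is the
   inclusion of the common vertices, [rd] the origin of the darts. *)
Record reduction (G G' : rooted_graph) := Reduction {
  rv : vert G' -> vert G;
  rd : dart G' -> origin G;
  rv_inj : injective rv;
  rv_range : forall v, (exists v', rv v' = v) <-> ~ interior_vert (root G) v;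
  rd_inj : injective rd;
  rd_range : forall x, (exists d', rd d' = x) <-> valid_origin x;
  red_inc : forall d',
    omap rv (inc d') = match rd d' with inl d => inc d | inr (_, o) => o end;
  red_inv_old : forall d' d, rd d' = inl d -> rd (inv d') = inl (inv d);
  red_inv_new : forall d' A o, rd d' = inr (A, o) ->
    exists2 o', o' <> o & rd (inv d') = inr (A, o');
  red_color_old : forall d' d, rd d' = inl d -> color d' = color d;
  red_kind_old : forall d' d, rd d' = inl d -> kind d' = kind d;
  red_pos_old : forall d' d, rd d' = inl d -> pos d' = pos d;
  red_color_new : forall d' A o, rd d' = inr (A, o) ->
    forall d : dart G, color d' <> color d;
  red_color_class : forall d1 d2 A1 A2 o1 o2,
    rd d1 = inr (A1, o1) -> rd d2 = inr (A2, o2) ->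
    (color d1 = color d2 <-> exists f g, boundary_iso (root G) A1 A2 f g);
  red_kind_new : forall d' A o, rd d' = inr (A, o) ->
    replacing_type (root G) A (kind d');
  red_pos_new : forall d1 d2 A1 A2 u f g,
    rd d1 = inr (A1, Some u) -> rd d2 = inr (A2, Some (f u)) ->
    replacing_type (root G) A1 Directed -> boundary_iso (root G) A1 A2 f g ->
    pos d1 = pos d2;
  red_root :
    match root G, root G' with
    | inl v, inl v' => rv v' = v
    | inr B, inr B' =>
        (forall v', v' \in B'.1 <-> rv v' \in B.1) /\
        (forall d', d' \in B'.2 <->
           match rd d' with
           | inl d => d \in B.2
           | inr (A, _) => exists2 d, d \in A.2 & d \in B.2
           end)
    | _, _ => False
    end
}.

Record reduction_series (G : graph) (r : nat) := ReductionSeries {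
  term : nat -> rooted_graph;
  term0 : rgraph (term 0) = G;
  center0 : is_center (root (term 0));
  step : forall j, j < r -> reduction (term j) (term j.+1);
  step_atom : forall j, j < r -> ~ primitive (root (term j));
  last_primitive : primitive (root (term r))
}.

(* -------------------------------------------------------------------------- *)
(* The reduction epimorphism                                                  *)
(* -------------------------------------------------------------------------- *)

Definition origin_map (G : graph) (p : {perm vert G} * {perm dart G})
    (x : origin G) : origin G :=
  match x with
  | inl d => inl (p.2 d)
  | inr (A, o) => inr ((p.1 @: A.1, p.2 @: A.2), omap p.1 o)
  end.

(* [q] is the automorphism of the reduced graph induced by [p]; it is unique
   since [rv] and [rd] are injective. *)
Definition induced (G G' : rooted_graph) (R : reduction G G')
    (p : {perm vert G} * {perm dart G}) (q : {perm vert G'} * {perm dart G'}) :=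
  (forall v', rv R (q.1 v') = p.1 (rv R v')) /\
  (forall d', rd R (q.2 d') = origin_map p (rd R d')).

Definition reduction_epimorphism (G G' : rooted_graph) (R : reduction G G')
    (Phi : {morphism AutG G >-> ({perm vert G'} * {perm dart G'})%type}) :=
  (forall p, p \in AutG G -> induced R p (Phi p)) /\ (Phi @* AutG G = AutG G')%g.

(* Main.v *)
(* Blocks are the classes of the relation "no single vertex separates the darts
   d and e", which gives the acyclicity of the block-tree and hence the uniqueness
   of its center; so automorphisms of G fix the root, preserve atoms, and induce
   automorphisms of the reduced graph.

   The boundary vertices of atoms survive in the reduced graph, because the new
   edges are incident with them; hence no boundary vertex of an atom lies in the
   interior of another one.  A walk inside the interior of one atom thus never
   meets the boundary of another, which makes the interiors of distinct atoms
   disjoint.  An automorphism of the reduced graph can then be lifted one atom at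
   a time: the color of e_A provides a boundary-preserving isomorphism onto the
   image atom, and its type decides whether the two boundary vertices can be
   exchanged when this isomorphism has the wrong direction.  Lifting also shows
   that automorphisms of the reduced graph fix its root, so the argument can be
   iterated along the series.  The first isomorphism theorem concludes. *)

Require Import Defs.
From mathcomp Require Import all_boot all_fingroup.
From Stdlib Require Import Classical IndefiniteDescription.

Set Implicit Arguments.
Unset Strict Implicit.
Unset Printing Implicit Defensive.

(** Two obstacles shape the proof. A [reduction] is a given structure, not a construction, so
    nothing is known in advance about how atoms meet. The disjointness lemmas are therefore stated
    under the hypothesis [not_interior], which is read off the surjectivity of [rd] onto the valid
    origins. Moreover, the root of a later term is only the image of the previous root, and nothing
    ties it to the center of its own block-tree. Its invariance is thus a hypothesis, [fixc],
    wherever parts are transported; the center enters only at the initial term.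

    The lifts of the single atoms are chosen independently. No coherence with composition is asked
    of them, since only surjectivity is wanted and not a homomorphic section. They have to agree at
    shared boundary vertices, and there the automorphism [q] being lifted already prescribes the
    values. *)

Local Notation inv := Defs.inv.

(** * Walks, blocks and separation by a single vertex *)

Section Blocks.

Variable G : graph.
Local Notation V := (vert G).
Local Notation D := (dart G).
Implicit Types (A B : subgraph G) (x y z : V + D) (d e : D) (u v w : V).

Local Notation off w := (remove (whole G) [set w]).

Definition link_step A : rel (V + D) :=
  [rel x y | [&& in_sub A x, in_sub A y & touch x y]].

Lemma touchC : symmetric (@touch G).
Proof.
have e_inv (d e : D) : inv d == e -> inv e == d.
  by move=> /eqP<-; rewrite invK.
by move=> [v|d] [w|e] //=; apply/idP/idP; exact: e_inv.
Qed.

Lemma linkedC A x y : linked A x y = linked A y x.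
Proof.
apply: sym_connect_sym => {}x {}y /=.
by rewrite touchC andbCA.
Qed.

Lemma linked_trans A : transitive (linked A).
Proof. by move=> y x z; apply: connect_trans. Qed.

Lemma linked1 A x y : in_sub A x -> in_sub A y -> touch x y -> linked A x y.
Proof. by move=> xA yA xy; apply: connect1; rewrite /= xA yA. Qed.

Lemma linkedP A x y :
  reflect (exists p, [/\ path (link_step A) x p, last x p = y & uniq (x :: p)])
          (linked A x y).
Proof.
apply: (iffP connectP) => [[p pP ->]|[p [pP lP _]]]; last by exists p.
by case/shortenP: pP => q qP qU _; exists q.
Qed.

Lemma path_linked A x p : path (link_step A) x p -> linked A x (last x p).
Proof. by move=> pP; apply/connectP; exists p. Qed.

Lemma path_in_sub A x p : path (link_step A) x p -> all (in_sub A) p.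
Proof.
by elim: p x => //= y p IH x /andP[/and3P[_ -> _] /IH].
Qed.

Lemma path_restrict A B x p :
  path (link_step A) x p -> all (in_sub B) (x :: p) -> path (link_step B) x p.
Proof.
elim: p x => //= y p IH x /andP[/and3P[_ _ xy] pP] /and3P[xB yB pB].
by rewrite /link_step /= xB yB xy IH //= yB.
Qed.

Lemma in_sub_remove A (U : {set V}) x :
  in_sub (remove A U) x = in_sub A x && (if x is inl v then v \notin U else true).
Proof. by case: x => [v|d] /=; rewrite ?inE ?andbT // andbC. Qed.

Lemma in_sub_whole x : in_sub (whole G) x.
Proof. by case: x => ? /=; rewrite inE. Qed.

Lemma in_off w x : in_sub (off w) x = (x != inl w).
Proof. by rewrite in_sub_remove in_sub_whole /=; case: x => //= v; rewrite inE. Qed.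

Lemma path_off A w x p : path (link_step A) x p -> inl w \notin x :: p ->
  path (link_step (remove A [set w])) x p.
Proof.
case: p => // y p pP; rewrite inE negb_or => /andP[wx wp].
have : all (in_sub A) (x :: y :: p).
  by apply/andP; split; [case/andP: pP => /and3P[] | exact: path_in_sub pP].
move/allP=> pA; apply: path_restrict pP _; apply/allP => z zp.
rewrite in_sub_remove pA //=; case: z zp => // v vp; rewrite inE.
apply: contraTneq vp => ->; rewrite inE negb_or; exact/andP.
Qed.

Lemma linked_sub A B x y : sub_le A B -> linked A x y -> linked B x y.
Proof.
move=> /andP[/subsetP s1 /subsetP s2]; apply: connect_sub => {}x {}y /= /and3P[xA yA xy].
have sAB z : in_sub A z -> in_sub B z by case: z => [v /s1|d /s2].
by apply: linked1; rewrite ?sAB.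
Qed.

Lemma sub_le_anti A B : sub_le A B -> sub_le B A -> A = B.
Proof.
case: A B => [a1 a2] [b1 b2] /andP[/= h1 h2] /andP[/= h3 h4].
by congr pair; apply/eqP; rewrite eqEsubset ?h1 ?h2.
Qed.

Lemma sub_le_whole A : sub_le A (whole G).
Proof. by rewrite /sub_le !subsetT. Qed.

Lemma sub_le_remove A B (U : {set V}) : sub_le A B -> sub_le (remove A U) (remove B U).
Proof. by case/andP=> h1 h2; rewrite /sub_le /= setSD. Qed.

Lemma linked_off A w x y : linked (remove A [set w]) x y -> linked (off w) x y.
Proof. by apply: linked_sub; apply: sub_le_remove; apply: sub_le_whole. Qed.

Lemma remove0 A : remove A set0 = A.
Proof. by rewrite /remove setD0; case: A. Qed.

(** A duplicate-free walk enters [w] only at its end, from a dart at [w]; everything before that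
    step avoids [w]. This turns reaching a vertex into reaching a dart at it after its removal. *)
Lemma linked_neighbour A x w : linked A x (inl w) -> x <> inl w ->
  exists d, [/\ d \in A.2, inc d = Some w & linked (remove A [set w]) x (inr d)].
Proof.
case/linkedP=> p [+ + +] xw; case/lastP: p => [|p y]; first by move=> _ /xw.
rewrite last_rcons rcons_path => /andP[pP +] yw; rewrite {y}yw => st.
rewrite -rcons_cons rcons_uniq => /andP[wp _].
have := path_linked (path_off pP wp); case: (last x p) st => [v|d] /and3P[] //= dA _ /eqP dw l.
by exists d.
Qed.

Lemma connectedP A : reflect (forall x y, in_sub A x -> in_sub A y -> linked A x y)
  (connected A).
Proof.
apply: (iffP forallP) => [h x y xA yA|h x].
  by have /forallP/(_ y) := h x; rewrite xA yA.
by apply/forallP=> y; apply/implyP=> xA; apply/implyP=> yA; apply: h.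
Qed.

(** Stated for darts rather than vertices: removing [w] deletes no dart, so both ends stay available
    for every [w] and transitivity is immediate. The first conjunct covers a graph without vertices,
    where the second is void. *)
Definition same_block d e := linked (whole G) (inr d) (inr e) &&
  [forall w, linked (off w) (inr d) (inr e)].

Lemma same_blockP d e :
  reflect (linked (whole G) (inr d) (inr e) /\ forall w, linked (off w) (inr d) (inr e))
          (same_block d e).
Proof.
apply: (iffP andP) => [[h /forallP]|[h k]] //; split => //; exact/forallP.
Qed.

Lemma same_block_refl d : same_block d d.
Proof. by apply/same_blockP; split => [|w]; apply: connect0. Qed.

Lemma same_blockC d e : same_block d e = same_block e d.
Proof.
by apply/same_blockP/same_blockP => -[h k]; split => [|w]; rewrite linkedC.
Qed.

Lemma same_block_trans : transitive same_block.
Proof.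
move=> e d f /same_blockP[h k] /same_blockP[h' k']; apply/same_blockP.
by split => [|w]; [apply: linked_trans h'| apply: linked_trans (k' w)].
Qed.

Lemma same_block_inv d : same_block d (inv d).
Proof.
by apply/same_blockP; split => [|w]; apply: linked1; rewrite /= ?inE /=.
Qed.

Definition block_of d : subgraph G :=
  ([set v | [exists e, same_block d e && (inc e == Some v)]], [set e | same_block d e]).

Lemma block_of_eq d e : same_block d e -> block_of d = block_of e.
Proof.
move=> de; have E f : same_block d f = same_block e f.
  apply/idP/idP; apply: same_block_trans => //; by rewrite same_blockC.
congr pair; apply/setP => f; rewrite !inE //.
by apply: eq_existsb => g; rewrite E.
Qed.

(* A dart off the block of [d] is separated from it by a single vertex, which a
   path from the block to this dart and back would have to cross twice. *)
Lemma uniq_path_same_block (U : {set V}) d e p :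
  path (link_step (remove (whole G) U)) (inr d) p -> last (inr d) p = inr e ->
  uniq (inr d :: p : seq (V + D)) -> same_block d e ->
  forall g, inr g \in (inr d :: p : seq (V + D)) -> same_block d g.
Proof.
move=> pP lp pU de g gp.
have pW : path (link_step (whole G)) (inr d) p.
  by apply: path_restrict pP _; apply/allP => z _; apply: in_sub_whole.
move: gp pW lp pU {pP}; case/splitPl => p1 p2 l1.
rewrite cat_path last_cat l1 => /andP[P1 P2] l2.
rewrite -cat_cons cat_uniq => /and3P[_ /hasPn hU _].
apply/same_blockP; split; first by rewrite -l1; apply: path_linked.
move=> z; apply/negPn/negP => nz.
have z1 : inl z \in (inr d :: p1 : seq (V + D)).
  apply: contraR nz => nz; rewrite -l1.
  exact: path_linked (path_off P1 nz).
have nz2 : inl z \notin (inr g :: p2 : seq (V + D)).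
  rewrite inE /=; apply/negP => zp; have /negP := hU _ zp; exact.
have := path_linked (path_off P2 nz2); rewrite l2 => ge.
case/same_blockP: de => _ /(_ z) de.
by move/negP: nz; apply; apply: linked_trans de _; rewrite linkedC.
Qed.

(** A duplicate-free walk between two darts of a class meets only darts of that class. Each vertex
    on it is preceded by such a dart, so the walk already lies inside the block. *)
Lemma linked_block_of (U : {set V}) d e f :
  same_block d e -> same_block d f -> linked (remove (whole G) U) (inr e) (inr f) ->
  linked (remove (block_of d) U) (inr e) (inr f).
Proof.
move=> de df /linkedP[p [pP lp pU]].
have ef : same_block e f by apply: same_block_trans df; rewrite same_blockC.
have H g : inr g \in (inr e :: p : seq (V + D)) -> same_block d g.
  by move=> gp; apply: same_block_trans de _; apply: uniq_path_same_block pP lp pU ef g gp.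
rewrite -lp; apply: path_linked; apply: (path_restrict pP).
apply/allP => -[v|g] gp; last by rewrite /= inE H.
have vp : inl v \in p by rewrite inE in gp.
move: vp pP lp {pU gp} H; case/splitPr => p1 p2; rewrite cat_path => /andP[_ /andP[st _]] _ H.
have := mem_last (inr e) p1.
case: (last _ _) st => [w|g] /and3P[] //= _; rewrite !inE => /andP[vU _] gv gp.
rewrite vU; apply/existsP; exists g; rewrite gv andbT H //.
by rewrite -cat_cons mem_cat; apply/orP; left; rewrite inE.
Qed.

(** Applied with [U] empty for connectedness and with [U] a singleton for the absence of
    articulations. *)
Lemma connected_block_of (U : {set V}) d :
  (forall e, same_block d e -> linked (remove (whole G) U) (inr d) (inr e)) ->
  connected (remove (block_of d) U).
Proof.
move=> hU; have toD x : in_sub (remove (block_of d) U) x ->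
    exists2 e, same_block d e & linked (remove (block_of d) U) x (inr e).
  case: x => [v|e]; last by rewrite /= inE => de; exists e => //; apply: connect0.
  move=> vB; move: (vB); rewrite in_sub_remove /= inE => /andP[/existsP[e /andP[de ev]] _].
  by exists e => //; apply: linked1 => //; rewrite /= inE.
apply/connectedP => x y /toD[e de xe] /toD[f df yf].
apply: linked_trans xe _; rewrite linkedC; apply: linked_trans yf _.
by apply: linked_block_of => //; apply: linked_trans (hU e de); rewrite linkedC hU.
Qed.

Lemma two_connected_block_of d : two_connected (block_of d).
Proof.
apply/and4P; split.
- apply/forall_inP => e; rewrite inE => de; apply/andP; split.
    by rewrite inE; apply: same_block_trans de (same_block_inv e).
  by case E: (inc e) => [v|] //; rewrite inE; apply/existsP; exists e; rewrite de E eqxx.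
- by apply/set0Pn; exists d; rewrite inE same_block_refl.
- rewrite -[block_of d]remove0; apply: connected_block_of => e /same_blockP[h _].
  by rewrite remove0.
- apply/forallP => u; rewrite /articulation negb_and negbK orbC.
  by rewrite connected_block_of // => e /same_blockP[].
Qed.

Lemma two_connectedP A : two_connected A -> 
  [/\ closed_sub A, A.2 != set0, connected A & forall u, connected (remove A [set u])].
Proof.
case/and4P=> h1 h2 h3 /forallP h4; split => // u.
have := h4 u; rewrite negb_and negbK => /orP[uA|//].
suff -> : remove A [set u] = A by [].
case: A uA {h1 h2 h3 h4} => a1 a2 /= uA; congr pair; apply/setP => v; rewrite !inE.
by case: eqP => // ->; rewrite (negPf uA).
Qed.

Lemma two_connected_dart A v : two_connected A -> v \in A.1 ->
  exists2 d, d \in A.2 & inc d = Some v.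
Proof.
case/two_connectedP=> _ /set0Pn[d dA] /connectedP cA _ vA.
have : linked A (inr d) (inl v) by apply: cA.
by case/linked_neighbour=> // e [eA ev _]; exists e.
Qed.

Lemma two_connected_sub A d : two_connected A -> d \in A.2 -> sub_le A (block_of d).
Proof.
move=> tA dA; case/two_connectedP: (tA) => cl _ /connectedP cA rA.
have H e : e \in A.2 -> same_block d e.
  move=> eA; apply/same_blockP; split.
    by apply: linked_sub (sub_le_whole A) _; apply: cA.
  by move=> w; apply: linked_off; have /connectedP := rA w; apply.
apply/andP; split; apply/subsetP; last by move=> e eA; rewrite inE H.
move=> v vA; rewrite inE; have [e eA ev] := two_connected_dart tA vA.
by apply/existsP; exists e; rewrite H // ev eqxx.
Qed.

Lemma mem_block_of d : d \in (block_of d).2.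
Proof. by rewrite inE same_block_refl. Qed.

Lemma inc_block_of d v : inc d = Some v -> v \in (block_of d).1.
Proof.
by move=> dv; rewrite inE; apply/existsP; exists d; rewrite same_block_refl dv eqxx.
Qed.

Lemma block_of_block d : block (block_of d).
Proof.
rewrite /block two_connected_block_of; apply/forallP => B.
apply/implyP => tB; apply/implyP => sB; apply/eqP/sub_le_anti => //.
apply: two_connected_sub => //; case/andP: sB => _ /subsetP; apply; exact: mem_block_of.
Qed.

(** By [two_connected_sub] the block lies below the class of any of its darts, and maximality makes
    the two equal. *)
Lemma blockE B d : block B -> d \in B.2 -> B = block_of d.
Proof.
case/andP=> tB /forallP/(_ (block_of d)); rewrite two_connected_block_of => /= hB dB.
by rewrite two_connected_sub //= in hB; apply/esym/eqP.
Qed.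

Lemma block_two B : block B -> two_connected B.
Proof. by case/andP. Qed.

Lemma block_has_dart B : block B -> exists d, d \in B.2.
Proof. by case/block_two/two_connectedP=> _ /set0Pn. Qed.

Lemma block_closed B d : block B -> d \in B.2 ->
  inv d \in B.2 /\ forall v, inc d = Some v -> v \in B.1.
Proof.
case/block_two/two_connectedP=> /forall_inP cl _ _ _ /cl/andP[h k].
by split=> // v dv; rewrite dv in k.
Qed.

Lemma block_linked_off B w x y : block B -> in_sub B x -> in_sub B y ->
  x <> inl w -> y <> inl w -> linked (off w) x y.
Proof.
case/block_two/two_connectedP=> _ _ _ rB xB yB xw yw.
apply: linked_off; have /connectedP := rB w; apply; rewrite in_sub_remove.
  by rewrite xB; case: x xB xw => //= v _ vw; rewrite inE; apply/eqP => E; apply: vw; rewrite E.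
by rewrite yB; case: y yB yw => //= v _ vw; rewrite inE; apply/eqP => E; apply: vw; rewrite E.
Qed.

Lemma block_linked B x y : block B -> in_sub B x -> in_sub B y -> linked (whole G) x y.
Proof.
case/block_two/two_connectedP=> _ _ /connectedP cB _ xB yB.
by apply: linked_sub (sub_le_whole B) _; apply: cB.
Qed.

(** If [d] and [e] were linked off [v], they would be linked off every vertex: for [w] other than
    [v], the two blocks connect both darts to [v] while avoiding [w]. They would then share a
    block. *)
Lemma blocks_separated B B' v d e : block B -> block B' -> B <> B' ->
  v \in B.1 -> v \in B'.1 -> d \in B.2 -> e \in B'.2 ->
  ~~ linked (off v) (inr d) (inr e).
Proof.
move=> bB bB' neq vB vB' dB eB'; apply/negP => de.
apply: neq; rewrite (blockE bB dB) (blockE bB' eB'); apply: block_of_eq.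
apply/same_blockP; split.
  by apply: (linked_trans (y := inl v)); [apply: (block_linked bB)| apply: (block_linked bB')].
move=> w; case: (eqVneq w v) => [-> //|wv].
have vw : (inl v : V + D) <> inl w by case=> E; rewrite E eqxx in wv.
by apply: (linked_trans (y := inl v));
  [apply: (block_linked_off bB)| apply: (block_linked_off bB')].
Qed.

Lemma articulation_of_blocks B B' v : block B -> block B' -> B <> B' ->
  v \in B.1 -> v \in B'.1 -> articulation (whole G) v.
Proof.
move=> bB bB' neq vB vB'; rewrite /articulation inE /=; apply/negP => /connectedP c.
have [d dB] := block_has_dart bB; have [e eB] := block_has_dart bB'.
by have /negP := blocks_separated bB bB' neq vB vB' dB eB; apply; apply: c; rewrite in_off.
Qed.

(** * The block-tree *)

Definition covers (n : node G) x := match n with inl v => x = inl v | inr B => in_sub B x end.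

Lemma covers_linked_off (n : node G) w x y : bt_node n -> covers n x -> covers n y ->
  x <> inl w -> y <> inl w -> linked (off w) x y.
Proof.
case: n => [v|B] /=; last exact: block_linked_off.
by move=> _ -> ->; rewrite /linked connect0.
Qed.

Lemma bt_adj_node (m n : node G) : bt_adj m n -> bt_node m /\ bt_node n.
Proof. by case/and3P. Qed.

Lemma bt_adj_vb u B : bt_adj (inl u : node G) (inr B) =
  [&& articulation (whole G) u, block B & u \in B.1].
Proof. reflexivity. Qed.

Lemma bt_adjC : symmetric (@bt_adj G).
Proof.
move=> m n; rewrite /bt_adj andbCA; congr (_ && (_ && _)).
by case: m n => [u|A] [v|B].
Qed.

Lemma bt_adj_same (m n : node G) : bt_adj m n ->
  match m, n with inl _, inr _ | inr _, inl _ => true | _, _ => false end.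
Proof. by case/and3P=> _ _; case: m n => [u|A] [v|B]. Qed.

(** Adjacent nodes share an articulation, which is not [w] when [w] is not on the tree walk. A graph
    walk avoiding [w] is thus pieced together node by node. *)
Lemma bt_path_linked_off w (m : node G) p x y : bt_node m -> path (@bt_adj G) m p ->
  inl w \notin m :: p -> covers m x -> covers (last m p) y ->
  x <> inl w -> y <> inl w -> linked (off w) x y.
Proof.
elim: p m x => [|n p IH] m x bm /=; first by move=> _ _; apply: covers_linked_off.
case/andP=> mn pP; rewrite inE negb_or => /andP[wm wp] xm yl xw yw.
have [_ bn] := bt_adj_node mn.
have [v [vm vn vw]] : exists v, [/\ covers m (inl v), covers n (inl v) & v <> w].
  have wn : inl w != n by move: wp; rewrite inE negb_or => /andP[].
  have /and3P[_ _] := mn.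
  case: m n wm wn {IH bm bn pP xm yl mn wp} => [v|A] [v'|B] // wm wn h; [exists v|exists v'];
    by split=> // E; rewrite E eqxx in wm wn.
have vw' : (inl v : V + D) <> inl w by case.
by apply: linked_trans (covers_linked_off bm xm vm xw vw') _; apply: (IH n).
Qed.

(** Acyclicity of the block-tree in the form of separation: a tree walk missing [u] would give a
    graph walk missing [u], against [blocks_separated]. *)
Lemma blocks_separated_bt B B' u p : block B -> block B' -> B <> B' ->
  u \in B.1 -> u \in B'.1 -> path (@bt_adj G) (inr B) p -> last (inr B) p = inr B' ->
  inl u \in p.
Proof.
move=> bB bB' neq uB uB' pP lp; apply/negPn/negP => up.
have [d dB] := block_has_dart bB; have [e eB] := block_has_dart bB'.
have /negP := blocks_separated bB bB' neq uB uB' dB eB; apply.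
have up' : inl u \notin (inr B :: p : seq (node G)) by rewrite inE.
by apply: (@bt_path_linked_off u (inr B) p (inr d) (inr e) bB pP up' dB) => //; rewrite lp.
Qed.

(** The dual separation. On a duplicate-free walk, suppose that the first block [B1] is not [B]. The
    last node [v] is an articulation, so the walk can be prolonged from [v] to [B]; it then joins
    two distinct blocks at [u] and has to return to [u]. *)
Lemma vertices_separated_bt B u v p : block B -> u <> v -> u \in B.1 -> v \in B.1 ->
  path (@bt_adj G) (inl u) p -> last (inl u) p = inl v -> inr B \in p.
Proof.
move=> bB uv uB vB pP; case/shortenP: pP => q qP qU qp lq.
suff: inr B \in q by move/qp.
case: q qP qU lq {p qp} => [|n p] //=; first by move=> _ _ [].
case/andP=> un pP /and3P[up _ _] lp.
case: n un pP up lp => [v'|B1] un pP up lp; first by have := bt_adj_same un.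
have := un; rewrite bt_adj_vb => /and3P[_ bB1 uB1].
rewrite inE; case: eqVneq => [//|BB1] /=; apply/negPn/negP => Bp.
have vB' : bt_adj (inl v : node G) (inr B).
  case/lastP: p lp pP {up Bp} => [//|p y]; rewrite last_rcons rcons_path => -> /andP[_].
  by case/bt_adj_node => _ /= av; rewrite bt_adj_vb bB vB av.
have : inl u \in rcons p (inr B).
  apply: (@blocks_separated_bt B1 B) => //; last by rewrite last_rcons.
    by move=> E; rewrite E eqxx in BB1.
  by rewrite rcons_path pP lp vB'.
by rewrite mem_rcons inE /= => h; rewrite inE /= h in up.
Qed.

Lemma blocks_connect_common x B B' : block B -> block B' -> in_sub B x -> in_sub B' x ->
  connect (@bt_adj G) (inr B) (inr B').
Proof.
move=> bB bB'; case: x => [v|d] /= xB xB'; last by rewrite (blockE bB xB) (blockE bB' xB').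
case: (eqVneq B B') => [->|/eqP neq]; first exact: connect0.
have av := articulation_of_blocks bB bB' neq xB xB'.
apply: (connect_trans (y := inl v)); apply: connect1; last by rewrite bt_adj_vb av bB'.
by rewrite bt_adjC bt_adj_vb av bB.
Qed.

Lemma blocks_connect x y B B' : linked (whole G) x y -> block B -> block B' ->
  in_sub B x -> in_sub B' y -> connect (@bt_adj G) (inr B) (inr B').
Proof.
case/linkedP=> p [pP + _]; elim: p x B pP => [|z p IH] x B /=.
  by move=> _ -> ; apply: blocks_connect_common.
case/andP=> /and3P[_ _ xz] pP lp bB bB' xB yB'.
(* Every step of a walk has a dart at one of its ends, and the block of that dart covers both
   ends. *)
have [B0 [b0 x0 z0]] : exists B0, [/\ block B0, in_sub B0 x & in_sub B0 z].
  case: x z {pP lp xB} xz => [v|d] [v'|e] //= /eqP xz; last first.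
  - exists (block_of d); rewrite /= -xz; split; [exact: block_of_block|exact: mem_block_of|].
    by rewrite inE same_block_inv.
  - exists (block_of d); split; [exact: block_of_block|exact: mem_block_of|exact: inc_block_of].
  - exists (block_of e); split; [exact: block_of_block|exact: inc_block_of|exact: mem_block_of].
apply: connect_trans (blocks_connect_common bB b0 xB x0) _.
exact: (IH z B0).
Qed.

Hypothesis Gconn : connected (whole G).

Lemma linked_whole x y : linked (whole G) x y.
Proof. by move/connectedP: Gconn; apply; apply: in_sub_whole. Qed.

(* The two blocks come from the two sides of the articulation. *)
Lemma articulation_blocks u : articulation (whole G) u ->
  exists B B', [/\ block B, block B', B <> B', u \in B.1 & u \in B'.1].
Proof.
rewrite /articulation inE /= => nc.
have [x [y [xu yu nxy]]] : exists x y, [/\ x <> inl u, y <> inl u & ~~ linked (off u) x y].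
  apply: NNPP => h; move/negP: nc; apply; apply/connectedP => x y.
  rewrite !in_off => /eqP xu /eqP yu; apply/negPn/negP => nl; apply: h; by exists x, y.
have [d [_ du xd]] := linked_neighbour (linked_whole x (inl u)) xu.
have [e [_ eu ye]] := linked_neighbour (linked_whole y (inl u)) yu.
exists (block_of d), (block_of e); split; try exact: block_of_block; try exact: inc_block_of.
move=> E; have : same_block d e by have := mem_block_of e; rewrite -E inE.
case/same_blockP=> _ /(_ u) de; move/negP: nxy; apply.
by apply: linked_trans xd _; apply: linked_trans de _; rewrite linkedC.
Qed.

Lemma bt_connect (m n : node G) : bt_node m -> bt_node n -> connect (@bt_adj G) m n.
Proof.
have toB k : bt_node k -> exists B, block B /\
    (connect (@bt_adj G) k (inr B) /\ connect (@bt_adj G) (inr B) k).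
  case: k => [u|B] /= bk; last by exists B; rewrite connect0.
  have [B [_ [bB _ _ uB _]]] := articulation_blocks bk.
  by exists B; split=> //; split; apply: connect1; rewrite /bt_adj /= bk bB uB.
move=> /toB[B [bB [mB _]]] /toB[B' [bB' [_ Bn]]].
apply: connect_trans mB _; apply: connect_trans Bn.
have [d dB] := block_has_dart bB; have [e eB] := block_has_dart bB'.
exact: (blocks_connect (linked_whole (inr d) (inr e))).
Qed.

End Blocks.

(** * The action of automorphisms on subgraphs and on the block-tree *)

Section Automorphisms.

Variable G : graph.
Local Notation V := (vert G).
Local Notation D := (dart G).
Implicit Types (A B K : subgraph G) (x y z : V + D) (d e : D) (u v w : V).
Implicit Types (p q s : {perm V} * {perm D}) (U : {set V}) (m n : node G).

Definition act_elt p x : V + D :=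
  match x with inl v => inl (p.1 v) | inr d => inr (p.2 d) end.

Definition act_sub p A : subgraph G := (p.1 @: A.1, p.2 @: A.2).

Definition act_node p n : node G :=
  match n with inl v => inl (p.1 v) | inr B => inr (act_sub p B) end.

Lemma mem_imset_perm (T : finType) (s : {perm T}) (X : {set T}) t :
  (t \in s @: X) = ((s^-1)%g t \in X).
Proof. by rewrite -{1}(permKV s t) mem_imset //; apply: perm_inj. Qed.

Lemma imset_permK (T : finType) (s : {perm T}) (X : {set T}) : (s^-1)%g @: (s @: X) = X.
Proof. by apply/setP => t; rewrite mem_imset_perm invgK mem_imset //; apply: perm_inj. Qed.

Lemma imset_perm_set2 (T : finType) (s : {perm T}) (t t' : T) :
  s @: [set t; t'] = [set s t; s t'].
Proof. by rewrite imsetU1 imset_set1. Qed.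

Lemma act_eltK p : cancel (act_elt p) (act_elt p^-1%g).
Proof. by case=> [v|d] /=; rewrite permK. Qed.

Lemma act_eltKV p : cancel (act_elt p^-1%g) (act_elt p).
Proof. by case=> [v|d] /=; rewrite permKV. Qed.

Lemma act_subK p : cancel (act_sub p) (act_sub p^-1%g).
Proof. by case=> X Y; rewrite /act_sub /= !imset_permK. Qed.

Lemma act_subKV p : cancel (act_sub p^-1%g) (act_sub p).
Proof. by move=> A; rewrite -{1}[p]invgK act_subK. Qed.

Lemma act_nodeK p : cancel (act_node p) (act_node p^-1%g).
Proof. by case=> [v|B] /=; rewrite ?permK ?act_subK. Qed.

Lemma act_nodeKV p : cancel (act_node p^-1%g) (act_node p).
Proof. by move=> n; rewrite -{1}[p]invgK act_nodeK. Qed.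

Lemma in_sub_act p A x : in_sub (act_sub p A) (act_elt p x) = in_sub A x.
Proof. by case: x => [v|d] /=; rewrite mem_imset //; apply: perm_inj. Qed.

Lemma mem_act_vert p A v : (p.1 v \in (act_sub p A).1) = (v \in A.1).
Proof. exact: (in_sub_act p A (inl v)). Qed.

Lemma mem_act_dart p A d : (p.2 d \in (act_sub p A).2) = (d \in A.2).
Proof. exact: (in_sub_act p A (inr d)). Qed.

Lemma act_remove p A U : act_sub p (remove A U) = remove (act_sub p A) (p.1 @: U).
Proof.
by congr pair => /=; apply/setP => v; rewrite !(inE, mem_imset_perm).
Qed.

Lemma act_whole p : act_sub p (whole G) = whole G.
Proof. by congr pair; apply/setP => t; rewrite mem_imset_perm !inE. Qed.

Lemma act_off p w : act_sub p (remove (whole G) [set w]) = remove (whole G) [set p.1 w].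
Proof. by rewrite act_remove act_whole imset_set1. Qed.

Lemma act_sub_le p A B : sub_le (act_sub p A) (act_sub p B) = sub_le A B.
Proof.
have H q A' B' : sub_le A' B' -> sub_le (act_sub q A') (act_sub q B').
  by case/andP=> h h'; apply/andP; split; apply: imsetS.
by apply/idP/idP => [/(H p^-1%g)|/H //]; rewrite !act_subK.
Qed.

Lemma autP p : reflect (forall d, preserves p.1 p.2 d) (p \in AutG G).
Proof.
have T (F : finType) (s : {perm F}) : perm_on setT s by apply/subsetP.
rewrite inE /= !T /=; apply: (iffP forall_inP) => [h d|h d _] //; exact: h.
Qed.

Lemma preserves_inc p d : preserves p.1 p.2 d -> inc (p.2 d) = omap p.1 (inc d).
Proof. by case/and5P=> /eqP. Qed.

Lemma preserves_inv p d : preserves p.1 p.2 d -> inv (p.2 d) = p.2 (inv d).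
Proof. by case/and5P=> _ /eqP. Qed.

Lemma preserves_color p d : preserves p.1 p.2 d -> color (p.2 d) = color d.
Proof. by case/and5P=> _ _ /eqP. Qed.

Lemma preserves_kind p d : preserves p.1 p.2 d -> kind (p.2 d) = kind d.
Proof. by case/and5P=> _ _ _ /eqP. Qed.

Section Invariance.

Variables (p : {perm V} * {perm D}) (autp : p \in AutG G).

Let pp d : preserves p.1 p.2 d. Proof. exact/autP. Qed.

Lemma act_inc d : inc (p.2 d) = omap p.1 (inc d).
Proof. exact: preserves_inc. Qed.

Lemma act_inv d : inv (p.2 d) = p.2 (inv d).
Proof. exact: preserves_inv. Qed.

Lemma act_kind d : kind (p.2 d) = kind d.
Proof. exact: preserves_kind. Qed.

Lemma act_inc_eq d v : (inc (p.2 d) == Some (p.1 v)) = (inc d == Some v).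
Proof.
rewrite act_inc; case: (inc d) => //= w.
by apply/eqP/eqP => -[]; [move/perm_inj=> ->|move=> ->].
Qed.

Lemma act_touch x y : touch (act_elt p x) (act_elt p y) = touch x y.
Proof.
case: x y => [v|d] [w|e] //=; rewrite ?act_inc_eq // act_inv.
by rewrite (inj_eq perm_inj).
Qed.

Lemma act_linked_sub A x y : linked A x y -> linked (act_sub p A) (act_elt p x) (act_elt p y).
Proof.
case/connectP=> q + ->; elim: q x => [|z q IH] x /=; first by rewrite /linked connect0.
case/andP=> /and3P[xA zA xz] /IH; apply: linked_trans; apply: linked1;
  by rewrite ?in_sub_act ?act_touch.
Qed.

End Invariance.

Lemma autV p : p \in AutG G -> p^-1%g \in AutG G.
Proof. by rewrite groupV. Qed.

Lemma act_linked p A x y : p \in AutG G ->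
  linked (act_sub p A) (act_elt p x) (act_elt p y) = linked A x y.
Proof.
move=> ap; apply/idP/idP; last exact: act_linked_sub.
by move/(act_linked_sub (autV ap)); rewrite act_subK !act_eltK.
Qed.

Lemma act_connected p A : p \in AutG G -> connected (act_sub p A) = connected A.
Proof.
move=> ap; apply/connectedP/connectedP => h x y.
  by have := h (act_elt p x) (act_elt p y); rewrite !in_sub_act act_linked.
rewrite -(act_eltKV p x) -(act_eltKV p y) !in_sub_act act_linked //; exact: h.
Qed.

Lemma act_articulation p u : p \in AutG G ->
  articulation (whole G) (p.1 u) = articulation (whole G) u.
Proof.
move=> ap; rewrite /articulation !inE /=; congr (~~ _).
by rewrite -act_off; apply: act_connected.
Qed.

Local Opaque articulation block linked connected.

Lemma act_same_block p d e : p \in AutG G -> same_block d e -> same_block (p.2 d) (p.2 e).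
Proof.
move=> ap /same_blockP[h k]; apply/same_blockP; split => [|w].
  by rewrite -(act_whole p); apply: (act_linked_sub ap h).
by rewrite -(permKV p.1 w) -act_off; apply: (act_linked_sub ap (k _)).
Qed.

Lemma act_block_of p d : p \in AutG G -> act_sub p (block_of d) = block_of (p.2 d).
Proof.
move=> ap; have E e : same_block (p.2 d) e = same_block d ((p.2)^-1%g e).
  apply/idP/idP => [/(act_same_block (autV ap))|/(act_same_block ap)] /=.
    by rewrite permK.
  by rewrite permKV.
congr pair; apply/setP => t; rewrite mem_imset_perm !inE ?E //.
apply/existsP/existsP => -[e /andP[de ev]].
  exists (p.2 e); rewrite E permK de /=.
  by rewrite -(act_inc_eq ap) permKV in ev.
exists ((p.2)^-1%g e); rewrite -E de /=.
by rewrite -(act_inc_eq ap) !permKV.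
Qed.

(** Argued through [block_of], so that maximality among two-connected subgraphs never has to be
    transported. *)
Lemma act_block p B : p \in AutG G -> block (act_sub p B) = block B.
Proof.
have H q A : q \in AutG G -> block A -> block (act_sub q A).
  move=> aq bA; have [d dA] := block_has_dart bA.
  rewrite (blockE bA dA).
  rewrite (act_block_of d aq).
  exact: block_of_block.
move=> ap; apply/idP/idP; last exact: H.
by move/(H _ _ (autV ap)); rewrite act_subK.
Qed.

Lemma act_bt_node p n : p \in AutG G -> bt_node (act_node p n) = bt_node n.
Proof. by move=> ap; case: n => [u|B] /=; rewrite ?act_articulation ?act_block. Qed.

Lemma act_bt_adj p m n : p \in AutG G ->
  bt_adj (act_node p m) (act_node p n) = bt_adj m n.
Proof.
move=> ap; rewrite /bt_adj !act_bt_node //; congr [&& _, _ & _].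
by case: m n => [u|A] [v|B] //; apply: mem_act_vert.
Qed.

Lemma act_bt_path p m r : p \in AutG G ->
  path (@bt_adj G) (act_node p m) (map (act_node p) r) = path (@bt_adj G) m r.
Proof.
by move=> ap; elim: r m => //= n r IH m; rewrite IH act_bt_adj.
Qed.

(** * The center of the block-tree *)

(** The form of acyclicity that the center argument uses; it joins the two separation lemmas,
    according to whether the middle node is a block or an articulation. *)
Lemma bt_separated (a m b : node G) r : bt_adj a m -> bt_adj m b -> a <> b ->
  path (@bt_adj G) a r -> last a r = b -> m \in r.
Proof.
move=> am mb; have := bt_adj_same mb; have := bt_adj_same am.
have [ba bm] := bt_adj_node am; have [_ bb] := bt_adj_node mb.
case: a m b am mb ba bm bb => [u|A] [w|B] [v|A'] // am mb ba bm bb _ _ ab rP lr.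
  rewrite bt_adj_vb in am; rewrite bt_adjC bt_adj_vb in mb.
  case/and3P: am => _ bB am; case/and3P: mb => _ _ mb.
  apply: (vertices_separated_bt bB _ am mb rP lr).
  by move=> E; apply: ab; rewrite E.
rewrite bt_adjC bt_adj_vb in am; rewrite bt_adj_vb in mb.
case/and3P: am => _ _ am; case/and3P: mb => _ _ mb.
apply: (blocks_separated_bt ba bb _ am mb rP lr).
by move=> E; apply: ab; rewrite E.
Qed.

Lemma bt_dist_le_mem m n k r : path (@bt_adj G) n r -> m \in r -> size r <= k.+1 ->
  bt_dist_le m (last n r) k.
Proof.
move=> + mr; case/splitPr: mr => r1 r2.
rewrite cat_path last_cat size_cat /= addnS ltnS => /and3P[_ _ r2P] sz.
by exists r2; split=> //; apply: leq_trans sz; apply: leq_addl.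
Qed.

(* The second node [m] of a path between two centers separates them, so every
   node is strictly closer to [m] than to one of the centers. *)
Lemma center_unique (c c' : node G) k : connected (whole G) ->
  (forall m j, bt_node m -> bt_ecc_le m j -> bt_ecc_le c j) ->
  (forall j, bt_ecc_le c j -> bt_ecc_le c' j) ->
  bt_node c -> bt_node c' -> bt_ecc_le c k ->
  match c, c' with inl _, inl _ | inr _, inr _ => true | _, _ => false end -> c = c'.
Proof.
move=> Gc cmin cc' bc bc' + ty.
(* Descent on the bound for the eccentricity of [c]. At 0 every node equals [c], in particular
   [c']. *)
elim: k => [|k IH] ek.
  have [q [_ + +]] := ek c' bc'; by case: q.
have /connectP[q0 q0P lq0] := bt_connect Gc bc bc'.
case/shortenP: q0P lq0 => q qP qU _ lq {q0}.
case: q qP qU lq => [|m q] qP qU lq; first by [].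
have /andP[cm mq] := qP; have [_ bm] := bt_adj_node cm.
case: q qP qU lq mq => [|b q] qP qU lq mq.
  (* Adjacent nodes are of different kinds, so two centers of the same kind are not adjacent. *)
  by have := bt_adj_same cm; move: ty; rewrite lq /=; case: (c); case: (m).
have /andP[mb bq] := mq.
(* Adjacency in the block-tree with [m] removed, where [c] and [b] are no longer connected. *)
pose e' := [rel n1 n2 : node G | [&& bt_adj n1 n2, n1 != m & n2 != m]].
have e'C : connect_sym e'.
  apply: sym_connect_sym => x y /=; rewrite bt_adjC; congr (_ && _); exact: andbC.
have toe' n r : path (@bt_adj G) n r -> m \notin n :: r -> connect e' n (last n r).
  elim: r n => [|n' r IHr] n /=; first by rewrite connect0.
  case/andP=> nn' yr; rewrite !inE !negb_or => /and3P[mn mn' mr].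
  apply: (connect_trans (y := n')); last by apply: IHr => //; rewrite inE negb_or mn'.
  by apply: connect1; rewrite /= nn' eq_sym mn eq_sym.
have cNm : c != m by case/andP: qU; rewrite inE negb_or => /andP[].
have cNb : c <> b.
  by move=> E; case/andP: qU; rewrite E !inE eqxx orbT.
have mNq : m \notin b :: q by case/and3P: qU.
have sep r r' : path (@bt_adj G) c r -> path (@bt_adj G) c' r' -> last c r = last c' r' ->
    (m \in r) || (m \in r').
  move=> rP r'P E; apply/negPn/negP; rewrite negb_or => /andP[mr mr'].
  have bc1 : connect e' b c' by rewrite lq; apply: toe'.
  have mc' : m != c' by apply: contraNneq mNq => ->; rewrite lq; exact: (mem_last b q).
  have c1r : connect e' c' (last c' r') by apply: toe' => //; rewrite inE negb_or mc'.
  have cr : connect e' c (last c r) by apply: toe' => //; rewrite inE negb_or eq_sym cNm.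
  have /connectP[t tP lt] : connect e' c b.
    apply: connect_trans cr _; rewrite E e'C; exact: connect_trans c1r.
  have tP' : path (@bt_adj G) c t by apply: sub_path tP => n1 n2 /andP[].
  have : m \in t by apply: (bt_separated cm mb cNb tP').
  apply/negP; elim: (t) (c) tP => //= a1 t' IHt a0 /andP[/and3P[_ _ ym] /IHt].
  by rewrite inE negb_or eq_sym ym.
have ek' := cc' _ ek.
(* Once [m] has eccentricity at most [k], minimality passes this bound on to [c]. *)
apply: IH; apply: (cmin m) => // n bn.
have [r [rP lr sr]] := ek n bn; have [r' [r'P lr' sr']] := ek' n bn.
case/orP: (sep r r' rP r'P (etrans lr (esym lr'))) => mr.
  by rewrite -lr; apply: bt_dist_le_mem rP mr sr.
by rewrite -lr'; apply: bt_dist_le_mem r'P mr sr'.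
Qed.

Lemma act_bt_ecc p n k : p \in AutG G -> bt_ecc_le n k -> bt_ecc_le (act_node p n) k.
Proof.
move=> ap h n' bn'; have [|r [rP lr sr]] := h (act_node p^-1%g n').
  by rewrite act_bt_node // groupV.
exists (map (act_node p) r); split; rewrite ?act_bt_path ?size_map //.
by rewrite last_map lr act_nodeKV.
Qed.

Lemma act_center p (c : node G) : connected (whole G) -> is_center c -> p \in AutG G ->
  act_node p c = c.
Proof.
rewrite /is_center => Gc; case: ifP => [/andP[/eqP V1 _] [v ->] _|_ [bc cmin] ap].
  rewrite /=; congr inl; have /fintype_le1P : #|V| <= 1 by rewrite V1.
  exact.
(* A crude bound on the eccentricity: a duplicate-free walk visits each node at most once. *)
pose k := #|[the finType of (V + subgraph G)%type]|.
have ek : bt_ecc_le c k.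
  move=> n /(bt_connect Gc bc)/connectP[r0 r0P ->].
  case/shortenP: r0P => r rP rU _; exists r; split=> //.
  have /card_uniqP/= E : uniq (c :: r : seq (V + subgraph G)) by [].
  by apply: ltnW; rewrite -[(size r).+1]E; apply: max_card.
apply/esym/(center_unique (k := k)) => //; first by move=> n; apply: act_bt_ecc.
  by rewrite act_bt_node.
by case: (c).
Qed.

End Automorphisms.

(* Without this, [done] unfolds these predicates. *)
Local Opaque articulation block linked connected.

(** * Automorphisms fixing the root preserve parts, atoms and symmetry types *)

Section PartInvariance.

Variables (G : graph) (c : node G).
Local Notation V := (vert G).
Local Notation D := (dart G).
Implicit Types (A B K : subgraph G) (x y z : V + D) (d e : D) (u v w : V).
Implicit Types (p q s : {perm V} * {perm D}) (U : {set V}) (m n : node G).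

Hypothesis fixc : forall p, p \in AutG G -> act_node p c = c.

Lemma act_in_subtree p m n : p \in AutG G -> in_subtree c m n ->
  in_subtree c (act_node p m) (act_node p n).
Proof.
move=> ap h r rP lr.
have -> : act_node p n :: r = map (act_node p) (n :: map (act_node p^-1%g) r).
  by rewrite /= mapK //; apply: act_nodeKV.
apply: map_f; apply: h.
  by rewrite -(act_bt_path _ _ ap) mapK //; apply: act_nodeKV.
by rewrite -{1}(act_nodeK p n) last_map lr fixc // autV.
Qed.

Lemma act_pendant p d : p \in AutG G -> pendant d -> pendant (p.2 d).
Proof.
move=> ap; rewrite /pendant (act_inv ap) !(act_inc ap).
by case: (inc d); case: (inc _).
Qed.

Lemma act_edge p d : p \in AutG G -> p.2 @: [set d; inv d] = [set p.2 d; inv (p.2 d)].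
Proof. by move=> ap; rewrite imset_perm_set2 (act_inv ap). Qed.

Lemma act_pendant_edge p A : p \in AutG G -> is_pendant_edge A ->
  is_pendant_edge (act_sub p A).
Proof.
move=> ap [d pd E]; exists (p.2 d); first exact: act_pendant.
by rewrite -act_edge //= E.
Qed.

Lemma act_block_part p A u : p \in AutG G -> block_part c A u ->
  block_part c (act_sub p A) (p.1 u).
Proof.
move=> ap [n [[bn nc hv hd] [npe att]]]; have aq := autV ap.
exists (act_node p n); split; [split|split].
- by rewrite act_bt_node.
- by move=> B E; rewrite -(fixc ap) => /(can_inj (act_nodeK p)); case: n E {bn hv hd att} nc => // B' _ h; exact: (h B').
- move=> v; rewrite mem_imset_perm; split.
    case/hv=> B [bB sB vB]; exists (act_sub p B).
    rewrite (act_block _ ap) mem_imset_perm; split=> //.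
    exact: (act_in_subtree ap sB).
  case=> B [bB sB vB]; apply/hv; exists (act_sub p^-1%g B).
  rewrite (act_block _ aq); split=> //; last by rewrite mem_imset_perm /= invgK permKV.
  by have := act_in_subtree aq sB; rewrite act_nodeK.
- move=> d; rewrite mem_imset_perm; split.
    case/hd=> B [bB sB dB]; exists (act_sub p B).
    rewrite (act_block _ ap) mem_imset_perm; split=> //.
    exact: (act_in_subtree ap sB).
  case=> B [bB sB dB]; apply/hd; exists (act_sub p^-1%g B).
  rewrite (act_block _ aq); split=> //; last by rewrite mem_imset_perm /= invgK permKV.
  by have := act_in_subtree aq sB; rewrite act_nodeK.
- by move/(act_pendant_edge aq); rewrite act_subK.
case: n {bn nc hv hd} att => [w ->|B [uB sB]] //; split.
  exact: (etrans (act_bt_adj (inl u) (inr B) ap) uB).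
exact: (act_in_subtree ap sB).
Qed.

Lemma act_degree_in p B u : p \in AutG G ->
  degree_in (act_sub p B) (p.1 u) = degree_in B u.
Proof.
move=> ap; rewrite /degree_in -(card_imset [set d in B.2 | _] (@perm_inj _ p.2)); apply: eq_card => d.
by rewrite -{1}(permKV p.2 d) in_set mem_act_dart (act_inc_eq ap) mem_imset_perm in_set.
Qed.

Lemma act_remove2 p A u v :
  remove (act_sub p A) [set p.1 u; p.1 v] = act_sub p (remove A [set u; v]).
Proof. by rewrite act_remove imset_perm_set2. Qed.

Lemma act_two_cut p B u v : p \in AutG G -> two_cut B u v ->
  two_cut (act_sub p B) (p.1 u) (p.1 v).
Proof.
move=> ap [uv uB vB [x [y [xB yB nl]]]]; split.
- by rewrite (inj_eq perm_inj).
- by rewrite mem_act_vert.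
- by rewrite mem_act_vert.
exists (p.1 x), (p.1 y); rewrite act_remove2.
rewrite -imset_perm_set2; split.
- by move: xB; rewrite !inE mem_act_vert mem_imset //; [rewrite !inE|apply: perm_inj].
- by move: yB; rewrite !inE mem_act_vert mem_imset //; [rewrite !inE|apply: perm_inj].
by rewrite -[inl (p.1 x)]/(act_elt p (inl x)) -[inl (p.1 y)]/(act_elt p (inl y)) act_linked.
Qed.

Lemma act_component_of p A x : p \in AutG G ->
  component_of (act_sub p A) (act_elt p x) = act_sub p (component_of A x).
Proof.
move=> ap; congr pair; apply/setP => t; rewrite mem_imset_perm 2!in_set.
  rewrite -{1 2}(permKV p.1 t) mem_act_vert; congr (_ && _).
  exact: (act_linked A x (inl _) ap).
rewrite -{1 2}(permKV p.2 t) mem_act_dart; congr (_ && _).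
exact: (act_linked A x (inr _) ap).
Qed.

Lemma act_component p A K : p \in AutG G -> component A K ->
  component (act_sub p A) (act_sub p K).
Proof.
move=> ap /existsP[x /andP[xA /eqP->]]; apply/existsP; exists (act_elt p x).
by rewrite in_sub_act xA act_component_of  // eqxx.
Qed.

Lemma act_free_edge p K : p \in AutG G -> is_free_edge K -> is_free_edge (act_sub p K).
Proof.
by move=> ap [d ->]; exists (p.2 d); rewrite /act_sub /= imset0 act_edge.
Qed.

Lemma act_misses_center p K : p \in AutG G -> misses_center c K ->
  misses_center c (act_sub p K).
Proof.
move=> ap; have := fixc ap; rewrite /misses_center; case: (c) => [w|C] [].
  by move=> E; rewrite -{2}E mem_act_vert.
move=> E; rewrite -{2}E; apply: contra => h; apply/subsetP => v vC.
rewrite -(mem_act_vert p); apply: (subsetP h); exact: imset_f.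
Qed.

Lemma act_proper_part p A u v : p \in AutG G -> proper_part c A u v ->
  proper_part c (act_sub p A) (p.1 u) (p.1 v).
Proof.
move=> ap [B [K [J [[bB cut du dv] [[cK cJ JK nf mc] ->]]]]].
exists (act_sub p B), (act_sub p K), (act_sub p J); split; [split|split].
- by rewrite act_block.
- exact: act_two_cut.
- by rewrite act_degree_in.
- by rewrite act_degree_in.
- rewrite -{1}(act_whole p) !act_remove2; split.
  + exact: act_component.
  + exact: act_component.
  + by rewrite act_sub_le.
  + by move/(act_free_edge (autV ap)); rewrite act_subK.
  + exact: act_misses_center.
by rewrite /act_sub /= !imsetU !imset_set1.
Qed.

Lemma act_joining p u v : p \in AutG G -> p.2 @: joining u v = joining (p.1 u) (p.1 v).
Proof.
move=> ap; apply/setP => d; rewrite mem_imset_perm -{2}(permKV p.2 d) 2!in_set.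
by rewrite (act_inv ap) !(act_inc_eq ap).
Qed.

Lemma act_dipole_part p A u v : p \in AutG G -> dipole_part A u v ->
  dipole_part (act_sub p A) (p.1 u) (p.1 v).
Proof.
move=> ap [uv hj ->]; split.
- by rewrite (inj_eq perm_inj).
- by rewrite -act_joining // card_imset //; apply: perm_inj.
by rewrite /act_sub imset_perm_set2 /= imsetU !act_joining.
Qed.

Lemma act_part p A : p \in AutG G -> part c A -> part c (act_sub p A).
Proof.
move=> ap [[u]|[u [v]]|[u [v]]] h.
- by apply: Or31; exists (p.1 u); apply: act_block_part.
- by apply: Or32; exists (p.1 u), (p.1 v); apply: act_proper_part.
- by apply: Or33; exists (p.1 u), (p.1 v); apply: act_dipole_part.
Qed.

Lemma act_atom p A : p \in AutG G -> atom c A -> atom c (act_sub p A).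
Proof.
move=> ap [pA mA]; split=> [|B pB]; first exact: act_part.
rewrite -{1}(act_subKV p B) act_sub_le => sB.
by rewrite -(mA _ (act_part (autV ap) pB) sB) act_subKV.
Qed.

Lemma act_block_atom p A u : p \in AutG G -> block_atom c A u ->
  block_atom c (act_sub p A) (p.1 u).
Proof.
move=> ap [aA bA nd]; split; [exact: act_atom|exact: act_block_part|].
move=> [v [w /(act_dipole_part (autV ap))]]; rewrite act_subK => h.
by apply: nd; exists (p.1^-1%g v), (p.1^-1%g w).
Qed.

Lemma act_two_atom p A u v : p \in AutG G -> two_atom c A u v ->
  two_atom c (act_sub p A) (p.1 u) (p.1 v).
Proof.
move=> ap [aA h]; split; first exact: act_atom.
by case: h => h; [left; apply: act_proper_part|right; apply: act_dipole_part].
Qed.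

Lemma act_boundary p A U : p \in AutG G -> boundary c A U ->
  boundary c (act_sub p A) (p.1 @: U).
Proof.
move=> ap [[u bA ->]|[u [v [tA ->]]]].
  by left; exists (p.1 u); rewrite ?imset_set1 //; apply: act_block_atom.
right; exists (p.1 u), (p.1 v); rewrite imset_perm_set2; split=> //.
exact: act_two_atom.
Qed.

Lemma act_interior_vert p v : p \in AutG G -> interior_vert c v -> interior_vert c (p.1 v).
Proof.
move=> ap [A [U [bA]]]; rewrite inE => /andP[vU vA].
exists (act_sub p A), (p.1 @: U); split; first exact: act_boundary.
by rewrite inE mem_act_vert vA mem_imset ?vU //; apply: perm_inj.
Qed.

Lemma act_interior_dart p d : p \in AutG G -> interior_dart c d -> interior_dart c (p.2 d).
Proof.
move=> ap [A [aA dA]]; exists (act_sub p A).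
by rewrite mem_act_dart; split=> //; apply: act_atom.
Qed.

Lemma act_boundary_iso p A U : p \in AutG G -> boundary c A U ->
  boundary_iso c A (act_sub p A) p.1 p.2.
Proof.
move=> ap bA; split; last first.
  by exists U, (p.1 @: U); split=> //; apply: act_boundary.
split=> //; try by move=> ? ? _ _; apply: perm_inj.
by move=> d _; apply/autP.
Qed.

(** * Invariance of the symmetry types *)

Lemma preserves_mul p q d : preserves p.1 p.2 d -> preserves q.1 q.2 (p.2 d) ->
  preserves (p * q)%g.1 (p * q)%g.2 d.
Proof.
case/and5P=> /eqP a1 /eqP a2 /eqP a3 /eqP a4 /implyP a5.
case/and5P=> /eqP b1 /eqP b2 /eqP b3 /eqP b4 /implyP b5.
rewrite /preserves !permM b1 a1 b2 a2 b3 a3 b4 a4 !eqxx /= andbC; apply/andP; split.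
  by apply/implyP => k; rewrite (eqP (b5 _)) ?a4 //; exact: a5.
by case: (inc d) => //= v; rewrite permM.
Qed.

Lemma perm_on_conj (T : finType) (X : {set T}) (s t : {perm T}) :
  perm_on X s -> perm_on (t @: X) (s ^ t)%g.
Proof.
move=> sX; apply/subsetP => a; rewrite inE; rewrite mem_imset_perm.
rewrite -{1 2}(permKV t a) permJ (inj_eq perm_inj) => h.
by apply: contraR h => h; rewrite (out_perm sX).
Qed.

Lemma act_aut_set p s A : p \in AutG G -> s \in aut_set A -> (s ^ p)%g \in aut_set (act_sub p A).
Proof.
move=> ap; rewrite !inE => /and3P[s1 s2 /forall_inP h].
apply/and3P; split; [exact: perm_on_conj|exact: perm_on_conj|].
apply/forall_inP => d; rewrite mem_imset_perm => dA.
have /autP pp := ap; have /autP pq := autV ap.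
rewrite /conjg; apply: preserves_mul => //.
by apply: preserves_mul => //; apply: h.
Qed.

Lemma act_aut_boundary p s A U : p \in AutG G -> s \in aut_boundary A U ->
  (s ^ p)%g \in aut_boundary (act_sub p A) (p.1 @: U).
Proof.
move=> ap; rewrite inE => /andP[sA /eqP sU]; rewrite inE act_aut_set //=.
apply/eqP; rewrite -{2}sU -!imset_comp; apply: eq_imset => v.
by rewrite /= !permM permK.
Qed.

Lemma act_exchanges p s u v : exchanges s u v -> exchanges (s ^ p)%g (p.1 u) (p.1 v).
Proof. by case=> E F; split; rewrite /= permJ ?E ?F. Qed.

Lemma act_semiregular p s A : p \in AutG G -> semiregular A <[s]>%g ->
  semiregular (act_sub p A) <[s ^ p]>%g.
Proof.
move=> ap h t; rewrite cycleJ mem_conjg => /h {}h fixt.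
have {}h : (t ^ p^-1)%g = 1%g.
  apply: h; case: fixt => [[v]|[d]|[d]]; rewrite mem_imset_perm => vA.
  - move=> E; apply: Or31; exists ((p.1)^-1%g v) => //.
    by rewrite /= permJ E.
  - move=> E; apply: Or32; exists ((p.2)^-1%g d) => //.
    by rewrite /= permJ E.
  - case=> kd E; apply: Or33; exists ((p.2)^-1%g d) => //; split.
      by rewrite (act_kind (autV ap)).
    move: E; rewrite /= permJ !inE (act_inv (autV ap)).
    by rewrite !(inj_eq perm_inj).
by rewrite -(conjgKV p t) h conj1g.
Qed.

Lemma act_halvable p A u v : p \in AutG G -> halvable_boundary A u v ->
  halvable_boundary (act_sub p A) (p.1 u) (p.1 v).
Proof.
move=> ap [s sA [o2 sr ex]]; exists (s ^ p)%g.
  by rewrite -imset_perm_set2; apply: act_aut_boundary.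
by split; [rewrite orderJ|apply: act_semiregular|apply: act_exchanges].
Qed.

Lemma act_exchangeable p A u v : p \in AutG G -> exchangeable_boundary A u v ->
  exchangeable_boundary (act_sub p A) (p.1 u) (p.1 v).
Proof.
move=> ap [s sA ex]; exists (s ^ p)%g; last exact: act_exchanges.
by rewrite -imset_perm_set2; apply: act_aut_boundary.
Qed.

Lemma act_replacing_type p A t : p \in AutG G -> replacing_type c A t ->
  replacing_type c (act_sub p A) t.
Proof.
move=> ap; have nh u v : ~ halvable_boundary A u v ->
    ~ halvable_boundary (act_sub p A) (p.1 u) (p.1 v).
  by move=> h /(act_halvable (autV ap)) /=; rewrite act_subK !permK.
have ne u v : ~ exchangeable_boundary A u v ->
    ~ exchangeable_boundary (act_sub p A) (p.1 u) (p.1 v).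
  by move=> h /(act_exchangeable (autV ap)) /=; rewrite act_subK !permK.
case: t => /=.
- move=> [u [v [tA h]]]; exists (p.1 u), (p.1 v); split; first exact: act_two_atom.
  exact: act_halvable.
- case=> [[u bA]|[u [v [tA h1 h2]]]].
    by left; exists (p.1 u); apply: act_block_atom.
  right; exists (p.1 u), (p.1 v); split; [exact: act_two_atom|exact: nh|].
  exact: act_exchangeable.
- move=> [u [v [tA h1 h2]]]; exists (p.1 u), (p.1 v); split; [|exact: nh|exact: ne].
  exact: act_two_atom.
Qed.

End PartInvariance.

(** * Components, and how a proper part is attached at its 2-cut *)

Section Components.

Variable G : graph.
Local Notation V := (vert G).
Local Notation D := (dart G).
Implicit Types (A B K J : subgraph G) (x y z : V + D) (d e : D) (u v w : V) (U : {set V}).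

Lemma linked_ind_step A (P : V + D -> Prop) x y : linked A x y -> P x ->
  (forall a b, in_sub A a -> in_sub A b -> touch a b -> P a -> P b) -> P y.
Proof.
move=> /linkedP[p [+ + _]] + st; elim: p x => [|z p IH] x /=; first by move=> _ ->.
by case/andP=> /and3P[xA zA xz] pP lp Px; apply: (IH z) => //; apply: st xz Px.
Qed.

Lemma linked_through A x y w : linked A x y -> ~~ linked (remove A [set w]) x y ->
  linked A x (inl w).
Proof.
case/linkedP=> p [pP lp _] nl.
have : inl w \in x :: p by apply: contraR nl => /(path_off pP)/path_linked; rewrite lp.
move=> wp; move: wp pP {lp}; case/splitPl => p1 p2 l1; rewrite cat_path => /andP[p1P _].
by rewrite -l1; apply: path_linked.
Qed.

Lemma in_component_of A x y : in_sub (component_of A x) y = in_sub A y && linked A x y.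
Proof. by case: y => [v|d] /=; rewrite inE. Qed.

Lemma in_sub_eq A B : (forall x, in_sub A x = in_sub B x) -> A = B.
Proof.
case: A B => [X Y] [X' Y'] E; congr pair; apply/setP => t.
  exact: (E (inl t)).
exact: (E (inr t)).
Qed.

Lemma component_eq A K x : component A K -> in_sub K x -> K = component_of A x.
Proof.
case/existsP=> z /andP[zA /eqP->]; rewrite in_component_of => /andP[xA zx].
apply: in_sub_eq => y; rewrite !in_component_of; congr (_ && _).
by apply/idP/idP; apply: linked_trans; rewrite // linkedC.
Qed.

Lemma component_subset A K x : component A K -> in_sub K x -> in_sub A x.
Proof. by case/existsP=> z /andP[_ /eqP->]; rewrite in_component_of => /andP[]. Qed.

Lemma component_nonempty A K : component A K -> exists x, in_sub K x.
Proof.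
case/existsP=> z /andP[zA /eqP->]; exists z.
by rewrite in_component_of zA; apply: connect0.
Qed.

Lemma component_touch A K x y : component A K -> in_sub K x -> in_sub A y -> touch x y ->
  in_sub K y.
Proof.
move=> cK xK yA xy; have xA := component_subset cK xK.
by rewrite (component_eq cK xK) in_component_of yA; apply: linked1.
Qed.

Lemma in_sub_le A B x : sub_le A B -> in_sub A x -> in_sub B x.
Proof. by case/andP=> /subsetP h /subsetP k; case: x => [v /h|d /k]. Qed.

Lemma setU_pairC u v : [set u; v] = [set v; u].
Proof. exact: setUC. Qed.

Lemma two_cutC B u v : two_cut B u v -> two_cut B v u.
Proof. by case=> uv uB vB h; split=> //; [rewrite eq_sym|rewrite setU_pairC]. Qed.

Lemma remove_remove A u v : remove (remove A [set v]) [set u] = remove A [set u; v].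
Proof. by rewrite /remove /= setDDl setUC. Qed.

(** All end-vertices of [d] and [inv d] lie in the 2-cut, since any other one would belong to [J].
    Nothing further can then be reached in the whole graph either. This is why the component [J] of
    a proper part contains a vertex. *)
Lemma dart_component_free B K J u v d : block B ->
  component (remove (whole G) [set u; v]) K -> component (remove B [set u; v]) J ->
  sub_le J K -> J.1 = set0 -> d \in J.2 -> K = (set0, [set d; inv d]).
Proof.
move=> bB cK cJ JK J0 dJ.
have novert w : inl w \notin [pred x : V + D | in_sub J x] by rewrite inE /= J0 inE.
have dK : in_sub K (inr d) by apply: in_sub_le JK _.
have iJ : inv d \in J.2.
  have dB : d \in B.2 := component_subset cJ (dJ : in_sub J (inr d)).
  apply: (component_touch (x := inr d) (y := inr (inv d)) cJ) => //=.
  by have [] := block_closed bB dB.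
have out e w : e \in J.2 -> inc e = Some w -> w \in [set u; v].
  move=> eJ ew; apply/negPn/negP => wU; move/negP: (novert w); apply; rewrite inE.
  have eB : e \in B.2 := component_subset cJ (eJ : in_sub J (inr e)).
  apply: (component_touch (x := inr e) (y := inl w) cJ) => //=; last by rewrite ew.
  by have [_ /(_ w ew) wB] := block_closed bB eB; rewrite inE wU.
have iK : in_sub K (inr (inv d)) by apply: in_sub_le JK _.
have H x : in_sub K x -> x = inr d \/ x = inr (inv d).
  rewrite (component_eq cK dK) in_component_of => /andP[_ dx].
  apply: (linked_ind_step (P := fun x => x = inr d \/ x = inr (inv d)) dx); first by left.
  move=> a b _ bU ab [] ea; move: ab; rewrite ea; case: b bU => [w|e] /=.
  - by rewrite inE => /andP[wU _] /eqP dw; rewrite (out _ _ dJ dw) in wU.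
  - by move=> _ /eqP <-; right.
  - by rewrite inE => /andP[wU _] /eqP dw; rewrite (out _ _ iJ dw) in wU.
  - by move=> _ /eqP <-; left; rewrite invK.
apply: in_sub_eq => -[w|e] /=; rewrite !inE.
  by apply/negP => /(H (inl w)) [].
apply/idP/idP => [/(H (inr e)) [] [->]|/orP[] /eqP->] //; rewrite ?eqxx ?orbT //.
Qed.

(** Take a vertex [x0] of [J] and a vertex [t] of [B] cut off from it by [u] and [v]. The block
    stays connected without [v], so [x0] reaches [t] there, necessarily through [u]; the dart by
    which [u] is first reached belongs to [J], hence to [K]. *)
Lemma proper_part_attached B K J u v : block B -> two_cut B u v ->
  component (remove (whole G) [set u; v]) K -> component (remove B [set u; v]) J ->
  sub_le J K -> ~ is_free_edge K -> exists2 d, d \in K.2 & inc d = Some u.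
Proof.
move=> bB [uv uB vB [x [y [xB yB nxy]]]] cK cJ JK nf.
have [x0 x0J] : exists x0 : V, x0 \in J.1.
  apply/set0Pn; apply/negP => /eqP J0; apply: nf.
  have [[w|d] zJ] := component_nonempty cJ; first by rewrite /= J0 inE in zJ.
  exists d; exact: (dart_component_free bB cK cJ JK J0 zJ).
have x0B := component_subset cJ (x0J : in_sub J (inl x0)).
have [t tB nt] : exists2 t, t \in (remove B [set u; v]).1 &
    ~~ linked (remove B [set u; v]) (inl x0) (inl t).
  case: (boolP (linked (remove B [set u; v]) (inl x0) (inl x))) => lx.
    exists y; first exact: yB.
    apply: contra nxy => ly; rewrite linkedC in lx; exact: linked_trans lx ly.
  by exists x; [exact: xB|exact: lx].
have /two_connectedP[_ _ _ /(_ v) /connectedP cB] := block_two bB.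
have inv_v a : a \in (remove B [set u; v]).1 -> in_sub (remove B [set v]) (inl a).
  by rewrite /= !inE negb_or => /andP[/andP[_ ->]].
have l0 : linked (remove B [set v]) (inl x0) (inl t) by apply: cB; apply: inv_v.
rewrite -remove_remove in nt.
have x0u : (inl x0 : V + D) <> inl u.
  by case=> E; move: x0B; rewrite E /= !inE eqxx.
have [d [dB du]] := linked_neighbour (linked_through l0 nt) x0u.
rewrite remove_remove => xd; exists d => //.
apply: (in_sub_le (x := inr d) JK).
by rewrite (component_eq cJ (x0J : in_sub J (inl x0))) in_component_of xd andbT.
Qed.

End Components.

(** * Atoms meet at boundary vertices only *)

Section Disjointness.

Variables (G : graph) (c : node G).
Local Notation V := (vert G).
Local Notation D := (dart G).
Implicit Types (A B K J : subgraph G) (x y z : V + D) (d e : D) (u v w : V) (U W : {set V}).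

Lemma proper_partP A u v : proper_part c A u v -> exists K,
  [/\ A = (u |: (v |: K.1), K.2), u <> v,
      component (remove (whole G) [set u; v]) K & ~ is_free_edge K] /\
  [/\ exists2 d, d \in K.2 & inc d = Some u & exists2 d, d \in K.2 & inc d = Some v].
Proof.
case=> B [K [J [[bB cut _ _] [[cK cJ JK nf _] ->]]]]; exists K; split; split=> //.
- by case: cut => /eqP.
- exact: proper_part_attached bB cut cK cJ JK nf.
rewrite setU_pairC in cK; rewrite setU_pairC in cJ.
exact: proper_part_attached bB (two_cutC cut) cK cJ JK nf.
Qed.

Lemma block_part_closed A u d : block_part c A u -> d \in A.2 ->
  inv d \in A.2 /\ forall v, inc d = Some v -> v \in A.1.
Proof.
case=> n [[_ _ hv hd] _] /hd[B [bB sB dB]]; have [iB vB] := block_closed bB dB.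
split; first by apply/hd; exists B.
by move=> v dv; apply/hv; exists B; split=> //; apply: vB.
Qed.

Lemma block_part_dart A u v : block_part c A u -> v \in A.1 ->
  exists2 d, d \in A.2 & inc d = Some v.
Proof.
case=> n [[_ _ hv hd] _] /hv[B [bB sB vB]].
have [d dB dv] := two_connected_dart (block_two bB) vB.
by exists d => //; apply/hd; exists B.
Qed.

(** When [d] lies in another block than the block [B] of the part at [v], the node [v] joins the two
    in the tree. A walk from the block of [d] to the root, prolonged backwards to [B], meets the
    node [n] determining the part. This node is not [v], and if it is [B], the original walk meets
    it again. *)
Lemma block_part_star A u v d : block_part c A u -> v \in A.1 -> v <> u ->
  inc d = Some v -> d \in A.2.
Proof.
case=> n [[bn _ hv hd] [_ att]] /hv[B [bB sB vB]] vu dv.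
apply/hd; exists (block_of d); split; [exact: block_of_block| |exact: mem_block_of].
have vd := inc_block_of dv; have bd := block_of_block d.
case: (eqVneq B (block_of d)) => [<- //|/eqP neq].
have av := articulation_of_blocks bB bd neq vB vd.
have Bv : bt_adj (inr B : node G) (inl v) by rewrite bt_adjC bt_adj_vb av bB.
have vBd : bt_adj (inl v : node G) (inr (block_of d)) by rewrite bt_adj_vb av bd.
move=> r rP lr.
have := sB (inl v :: inr (block_of d) :: r).
rewrite /= Bv vBd => /(_ rP lr); rewrite 2!inE => /or3P[/eqP nB|/eqP nv|//].
  (* Here [n] is [B] with parent [u]. The walk has to reach [u], and on its way from [v] to [u],
     both vertices of [B], it passes through [B]. *)
  subst n; case: att => uB su.
  have := su (inl v :: inr (block_of d) :: r).
  rewrite /= Bv vBd => /(_ rP lr); rewrite 3!inE => /or4P[//|/eqP[E]|//|ur].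
    by case: vu.
  rewrite inE; apply/orP; right.
  move: ur rP {lr}; case/splitPr => r1 r2; rewrite cat_path mem_cat => /andP[r1P /andP[ru _]].
  have uB1 : u \in B.1 by case/and3P: uB.
  have : inr B \in (inr (block_of d) :: rcons r1 (inl u) : seq (node G)).
    apply: (vertices_separated_bt (u := v) (v := u) bB vu vB uB1); last first.
      by rewrite /= last_rcons.
    by rewrite /= vBd rcons_path r1P.
  rewrite -rcons_cons mem_rcons in_cons => /orP[//|].
  rewrite in_cons => /orP[/eqP[E]|h]; [by case: neq|by apply/orP; left].
by subst n; case: vu; case: att => ->.
Qed.

Hypothesis Gconn : connected (whole G).

(** Only an articulation node [w] needs an argument. If no block at [w] belonged to its subtree, two
    distinct blocks at [w] would both have walks to the root avoiding [w], and would be linked off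
    [w] through the root. *)
Lemma block_part_attached A u : block_part c A u -> u \in A.1.
Proof.
case=> n [[bn _ hv _] [_ att]]; apply/hv.
have refl B : in_subtree c (inr B) (inr B) by move=> r _ _; rewrite inE eqxx.
case: n bn att {hv} => [w|B] bn att; last first.
  by exists B; split=> //; case: att => /and3P[].
rewrite att => {u att}.
have [B [B' [bB bB' neq wB wB']]] := articulation_blocks Gconn bn.
apply: NNPP => h.
have nsub B0 : block B0 -> w \in B0.1 -> exists r,
    [/\ path (@bt_adj G) (inr B0) r, last (inr B0) r = c & inl w \notin (inr B0 :: r : seq (node G))].
  move=> b0 w0; apply: NNPP => k; apply: h; exists B0; split=> // r rP lr.
  by apply/negPn/negP => wr; apply: k; exists r.
have [r [rP lr wr]] := nsub B bB wB; have [r' [r'P lr' wr']] := nsub B' bB' wB'.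
have [d dB] := block_has_dart bB; have [d' dB'] := block_has_dart bB'.
have /negP := blocks_separated bB bB' neq wB wB' dB dB'; apply.
(* The root ends a walk avoiding [w], so it is a vertex node other than [w], or a block, which has a
   dart. *)
have [z zc zw] : exists2 z, covers c z & z <> inl w.
  have : inl w \notin (c :: nil : seq (node G)).
    rewrite inE; apply: contra wr => /eqP->; rewrite -lr; exact: mem_last.
  rewrite inE; case: (c) lr => [v _|C lC] /=.
    by move=> h'; exists (inl v) => //; case=> E; rewrite E eqxx in h'.
  have bC : block C.
    case/lastP: r rP lC {wr} => [_ [<-] //|r n]; rewrite rcons_path last_rcons.
    by move=> /andP[_ /bt_adj_node[_ +]] E; rewrite E.
  by have [e eC] := block_has_dart bC; exists (inr e).
apply: (linked_trans (y := z)); [|rewrite linkedC];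
  [apply: (bt_path_linked_off (m := inr B) bB rP)|apply: (bt_path_linked_off (m := inr B') bB' r'P)];
  rewrite // ?lr ?lr' //.
Qed.

(* If the root is not reachable, the subtree condition is void. *)
Lemma block_part_unreachable A n0 : ~~ connect (@bt_adj G) n0 c -> bt_node n0 ->
  forall u, block_part c A u ->
  (forall v, v \in A.1 <-> exists2 B, block B & v \in B.1) /\ (forall d, d \in A.2).
Proof.
move=> nc b0 u [n [[_ _ hv hd] _]].
have sub B : block B -> in_subtree c n (inr B).
  move=> bB r rP lr; case/negP: nc; apply: connect_trans (bt_connect Gconn b0 (n := inr B) bB) _.
  by apply/connectP; exists r.
split=> [v|d].
  split=> [/hv[B [bB _ vB]]|[B bB vB]]; first by exists B.
  by apply/hv; exists B; split=> //; apply: sub.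
apply/hd; exists (block_of d).
by split; [exact: block_of_block|apply: sub; exact: block_of_block|exact: mem_block_of].
Qed.

(** A duplicate-free walk from [B'] to the root passes through [B], and the stretch after [B]
    contains the parent [u]. The stretch before [B] therefore avoids [u]. *)
Lemma subtree_linked_off B u B' d e : block B -> bt_adj (inl u : node G) (inr B) ->
  in_subtree c (inl u) (inr B) -> block B' -> in_subtree c (inr B) (inr B') ->
  connect (@bt_adj G) (inr B) c -> d \in B.2 -> e \in B'.2 ->
  linked (remove (whole G) [set u]) (inr d) (inr e).
Proof.
move=> bB uB su bB' sB Bc dB eB'.
have /connectP[r0 r0P lr0] := connect_trans (bt_connect Gconn (m := inr B') (n := inr B) bB' bB) Bc.
case/shortenP: r0P lr0 => r rP rU _ lr {r0}.
have := sB r rP (esym lr) => Br.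
move: Br rP rU lr; case/splitPl => r1 r2 l1; rewrite cat_path last_cat l1.
case/andP=> r1P r2P; rewrite -cat_cons cat_uniq => /and3P[_ /hasPn hU _] lr.
have ur2 : inl u \in r2 by have := su r2 r2P (esym lr); rewrite inE.
have ur1 : inl u \notin (inr B' :: r1 : seq (node G)) by apply: hU.
rewrite linkedC; apply: (@bt_path_linked_off G u (inr B') r1 (inr e) (inr d) bB' r1P ur1) => //.
by rewrite l1.
Qed.

Lemma boundaryP A U : boundary c A U -> atom c A /\
  [\/ exists2 u, U = [set u] & block_part c A u,
      exists u v, U = [set u; v] /\ proper_part c A u v |
      exists u v, U = [set u; v] /\ dipole_part A u v].
Proof.
case=> [[u [aA bA _] ->]|[u [v [[aA [pA|dA]] ->]]]]; split=> //.
- by apply: Or31; exists u.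
- by apply: Or32; exists u, v.
- by apply: Or33; exists u, v.
Qed.

Lemma atom_boundary A : atom c A -> exists U, boundary c A U.
Proof.
(* Dipoles are split off because [block_atom] excludes them. *)
move=> aA; case: (classic (exists u v, dipole_part A u v)) => [[u [v dA]]|nd].
  by exists [set u; v]; right; exists u, v; split=> //; split=> //; right.
case: (aA) => -[[u bA]|[u [v pA]]|//] _.
  by exists [set u]; left; exists u.
by exists [set u; v]; right; exists u, v; split=> //; split=> //; left.
Qed.

Lemma boundary_sub A U u : boundary c A U -> u \in U -> u \in A.1.
Proof.
case/boundaryP=> _ [[w -> bA]|[v [w [-> /proper_partP[K [[-> _ _ _] _]]]]]|[v [w [-> [_ _ ->]]]]].
- by rewrite inE => /eqP->; apply: block_part_attached.
- by rewrite !inE => /orP[] ->; rewrite ?orbT.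
- by [].
Qed.

Lemma boundary_closed A U d : boundary c A U -> d \in A.2 ->
  inv d \in A.2 /\ forall v, inc d = Some v -> v \in A.1.
Proof.
case/boundaryP=> _ [[w _ bA]|[v [w [_ /proper_partP[K [[-> _ cK _] _]]]]]|[v [w [_ [_ _ ->]]]]].
- exact: block_part_closed bA.
- move=> /= dK; split.
    by apply: (component_touch (x := inr d) (y := inr (inv d)) cK) => //=; rewrite inE.
  move=> v' dv; rewrite !inE.
  case: eqVneq => //= nv; case: eqVneq => //= nw.
  apply: (component_touch (x := inr d) (y := inl v') cK) => //=; last by rewrite dv.
  by rewrite !inE (negPf nv) (negPf nw).
rewrite !inE invK => /orP[/andP[/eqP h /eqP k]|/andP[/eqP h /eqP k]]; rewrite h k !eqxx ?orbT.
  by split=> // v' [<-]; rewrite !inE eqxx.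
by split=> // v' [<-]; rewrite !inE eqxx orbT.
Qed.

(** Together with [boundary_closed], this confines to the atom every walk that starts in its
    interior and avoids its boundary. *)
Lemma boundary_star A U v d : boundary c A U -> v \in A.1 -> v \notin U ->
  inc d = Some v -> d \in A.2.
Proof.
case/boundaryP=> _ [[w -> bA]|[u [w [-> /proper_partP[K [[-> _ cK _] _]]]]]|[u [w [-> [_ _ ->]]]]].
- by rewrite inE => vA /eqP vw; apply: block_part_star bA vA vw.
- rewrite /= !inE negb_or => /or3P[->//|->|vK]; first by rewrite andbF.
  move=> _ dv; apply: (component_touch (x := inl v) (y := inr d) cK) => //=.
  by rewrite dv.
by move=> /= ->.
Qed.

(** Lets questions about vertices be settled on darts. In a proper part, a walk inside the component
    from a dart at the boundary to an interior vertex arrives by a dart at that vertex. *)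
Lemma boundary_dart A U v : boundary c A U -> v \in A.1 ->
  exists2 d, d \in A.2 & inc d = Some v.
Proof.
case/boundaryP=> _ [[w _ bA]|[u [w [_ /proper_partP[K [[-> _ cK _] [du dw]]]]]]|[u [w [_ [_ j ->]]]]].
- exact: block_part_dart bA.
- rewrite /= !inE => /or3P[/eqP->|/eqP->|vK] //.
  have [d dK du'] := du.
  have vd : linked (remove (whole G) [set u; w]) (inl v) (inr d).
    have := component_eq cK (vK : in_sub K (inl v)) => E.
    have : in_sub K (inr d) by []. 
    by rewrite {1}E in_component_of => /andP[].
  have : exists2 e, e \in K.2 & inc e = Some v \/ (inl v : V + D) = inr d.
    rewrite linkedC in vd; have [//|e [eA ev de]] := linked_neighbour vd.
    exists e; last by left.
    have dK' : in_sub K (inr d) by [].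
    apply: (component_touch (x := inl v) (y := inr e) cK) => //=.
    by rewrite ev.
  by case=> e eK [ev|//]; exists e.
have /card_gt0P[d] : 0 < #|joining u w| by apply: ltn_trans j.
rewrite inE => /andP[/eqP du /eqP dw].
rewrite !inE => /orP[] /eqP->.
  by exists d => //; rewrite !inE du dw !eqxx.
by exists (inv d) => //; rewrite !inE invK du dw !eqxx orbT.
Qed.

Hypothesis not_interior : forall A U u, boundary c A U -> u \in U -> ~ interior_vert c u.

Lemma boundary_meet A U B W u : boundary c A U -> boundary c B W -> u \in U -> u \in B.1 ->
  u \in W.
Proof.
move=> bA bB uU uB; apply/negPn/negP => uW.
by apply: (not_interior bA uU); exists B, W; rewrite inE uW.
Qed.

(** [boundary] is only a relation, as one subgraph may be a part in several ways. A vertex of one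
    boundary missing from the other would be interior. *)
Lemma boundary_uniq A U W : boundary c A U -> boundary c A W -> U = W.
Proof.
move=> bU bW; apply/eqP; rewrite eqEsubset; apply/andP; split; apply/subsetP => u uU.
  by apply: (boundary_meet bU bW uU); apply: boundary_sub bU uU.
by apply: (boundary_meet bW bU uU); apply: boundary_sub bW uU.
Qed.

Lemma interior_touch A U x y : boundary c A U -> in_sub (remove A U) x -> touch x y ->
  in_sub (remove (whole G) U) y -> in_sub (remove A U) y.
Proof.
move=> bA; case: x y => [v|d] [w|e] //=; rewrite !inE.
- by move=> /andP[vU vA] /eqP ev _; apply: boundary_star bA vA vU ev.
- move=> dA /eqP dw; rewrite andbT => ->; have [_] := boundary_closed bA dA; exact.
- by move=> dA /eqP <- _; have [] := boundary_closed bA dA.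
Qed.

(* No vertex of one boundary lies inside the other atom, so a walk inside one
   interior never leaves the other. *)
Lemma interior_transfer A U B W x y : boundary c A U -> boundary c B W ->
  in_sub (remove A U) x -> in_sub (remove B W) x -> linked (remove (whole G) U) x y ->
  in_sub (remove A U) y && in_sub (remove B W) y.
Proof.
move=> bA bB xA xB xy.
apply: (linked_ind_step (P := fun y => in_sub (remove A U) y && in_sub (remove B W) y) xy).
  by rewrite xA.
move=> a b _ bU ab /andP[aA aB].
have bA' := interior_touch bA aA ab bU; rewrite bA' /=.
apply: (interior_touch bB aB ab); case: b bA' {bU ab} => [v|d] /=; rewrite !inE // andbT.
case/andP=> vU vA; apply/negP => vW; move/negP: vU; apply.
exact: boundary_meet bB bA vW vA.
Qed.

Lemma dipole_meet A u v d B W : dipole_part A u v -> boundary c A [set u; v] ->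
  boundary c B W -> d \in A.2 -> d \in B.2 -> u \in W /\ v \in W.
Proof.
move=> dA bA bB dA2 dB; have [iB vB] := boundary_closed bB dB.
have [_ viB] := boundary_closed bB iB.
have uv : u \in B.1 /\ v \in B.1.
  case: dA dA2 => _ _ -> /=; rewrite !inE => /orP[] /andP[/eqP h /eqP k];
    by split; first [exact: vB h|exact: viB k].
by case: uv => uB vB'; split; [apply: boundary_meet bA bB _ uB|apply: boundary_meet bA bB _ vB'];
  rewrite !inE eqxx ?orbT.
Qed.

(** Both ends of the common dart lie in [W]. Hence [W] is no singleton; if [B] were proper, its
    component would consist of this dart and its inverse, a free edge; and a dipole is determined by
    its two vertices. *)
Lemma dipole_disjoint A u v B W d : dipole_part A u v -> boundary c A [set u; v] ->
  boundary c B W -> d \in A.2 -> d \in B.2 -> A = B.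
Proof.
move=> dA bA bB dA2 dB; have [uW vW] := dipole_meet dA bA bB dA2 dB.
have [/eqP uv _ EA] := dA.
have [hd hid] : (forall w, inc d = Some w -> w \in [set u; v]) /\
    (forall w, inc (inv d) = Some w -> w \in [set u; v]).
  move: dA2; rewrite EA !inE => /orP[] /andP[/eqP -> /eqP ->];
    by split=> w [<-]; rewrite !inE eqxx ?orbT.
case/boundaryP: (bB) => _ [[w E _]|[u' [v' [E /proper_partP[K [[EB _ cK nf] _]]]]]|[u' [v' [E [_ _ EB]]]]].
- by move: uW vW; rewrite E !inE => /eqP uw /eqP vw; case: uv; rewrite uw vw.
- case: nf; exists d; move: dB; rewrite EB /= => dK.
  have sub2 w : w \in [set u; v] -> w \in [set u'; v'].
    by rewrite -E !inE => /orP[] /eqP->.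
  have iK : inv d \in K.2.
    by apply: (component_touch (x := inr d) (y := inr (inv d)) cK) => //=; rewrite inE.
  have H x : in_sub K x -> x = inr d \/ x = inr (inv d).
    rewrite (component_eq cK (dK : in_sub K (inr d))) in_component_of => /andP[_ dx].
    apply: (linked_ind_step (P := fun x => x = inr d \/ x = inr (inv d)) dx); first by left.
    move=> a b _ bU ab ea; case: b bU ab => [w|e] /=.
      by rewrite inE => /andP[/negP wU _]; case: ea => -> /= /eqP ew; case: wU; apply: sub2;
        [apply: hd|apply: hid].
    by move=> _; case: ea => -> /eqP <-; [right|left; rewrite invK].
  apply: in_sub_eq => -[w|e] /=; rewrite !inE; first by apply/negP => /(H (inl w)) [].
  by apply/idP/idP => [/(H (inr e)) [] [->]|/orP[] /eqP->]; rewrite ?eqxx ?orbT.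
move: uW vW; rewrite E !inE EA EB => /orP[] /eqP uu /orP[] /eqP vv.
- by case: uv; rewrite uu vv.
- by rewrite uu vv.
- by rewrite uu vv; congr pair; apply: setUC.
- by case: uv; rewrite uu vv.
Qed.

(* The interior of a proper atom is a single component of the complement of its
   boundary, so it lies inside any other interior that it meets. *)
Lemma proper_disjoint A u v B W d : proper_part c A u v -> boundary c A [set u; v] ->
  boundary c B W -> d \in A.2 -> d \in B.2 ->
  (forall x, in_sub (remove A [set u; v]) x -> in_sub (remove B W) x) /\ [set u; v] \subset W.
Proof.
move=> pA bA bB dA dB.
have [K [[EA uv cK _] [[e eK eu] [f fK fv]]]] := proper_partP pA.
have H x : in_sub (remove A [set u; v]) x -> in_sub (remove B W) x.
  move=> xA; have KA y : in_sub (remove A [set u; v]) y -> in_sub K y.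
    rewrite EA; case: y => [w|g] //=; rewrite !inE negb_or.
    by case/andP=> /andP[/negPf-> /negPf->].
  have : linked (remove (whole G) [set u; v]) (inr d) x.
    have dK := KA (inr d) dA; have := KA x xA.
    by rewrite (component_eq cK dK) in_component_of => /andP[].
  by move=> /(interior_transfer bA bB (x := inr d) dA dB)/andP[].
have eB : e \in B.2 by apply: (H (inr e)); rewrite EA.
have fB : f \in B.2 by apply: (H (inr f)); rewrite EA.
split=> //; apply/subsetP => w wU; apply: (boundary_meet bA bB wU).
have [_ he] := boundary_closed bB eB; have [_ hf] := boundary_closed bB fB.
by move: wU; rewrite !inE => /orP[] /eqP->; [apply: he|apply: hf].
Qed.

(** A walk from the common dart to a dart at [u] that avoids [u] stays in both interiors, so [u]
    lies in [B] and hence on its boundary: both parts are attached at [u]. If one of them comes from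
    a block node and the root is reachable, its darts are linked off [u], so it lies inside the
    other, and minimality gives equality. Two parts coming from the articulation [u] itself
    coincide. *)
Lemma block_disjoint A u B v d : block_part c A u -> boundary c A [set u] ->
  block_part c B v -> boundary c B [set v] -> d \in A.2 -> d \in B.2 -> A = B.
Proof.
move=> pA bA pB bB dA dB.
have uv : u = v.
  apply/eqP/negPn/negP => /eqP uv.
  have [e [_ eu de]] := @linked_neighbour G (whole G) (inr d) u (linked_whole Gconn _ _) ltac:(by []).
  have /andP[_ eB] := interior_transfer bA bB (x := inr d) (y := inr e) dA dB de.
  have [_ /(_ u eu) uB] := boundary_closed bB (eB : e \in B.2).
  have := boundary_meet bA bB (set11 u) uB; rewrite inE => /eqP; exact: uv.
subst v; have [aA mA] : atom c A by case/boundaryP: bA.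
have [aB mB] : atom c B by case/boundaryP: bB.
have incl A' B' B0 : block_part c A' u -> boundary c A' [set u] -> block_part c B' u ->
    boundary c B' [set u] -> d \in A'.2 -> d \in B'.2 -> bt_node (inr B0 : node G) ->
    attached_at c (inr B0) u ->
    (forall e, e \in A'.2 <-> exists B, [/\ block B, in_subtree c (inr B0) (inr B) & e \in B.2]) ->
    sub_le A' B'.
  move=> pA' bA' pB' bB' dA' dB' b0 [u0 s0] hd.
  case: (boolP (connect (@bt_adj G) (inr B0) c)) => [c0|nc0]; last first.
    have [hA1 hA2] := block_part_unreachable nc0 b0 pA'.
    have [hB1 hB2] := block_part_unreachable nc0 b0 pB'.
    apply/andP; split; apply/subsetP; first by move=> w /hA1/hB1.
    by move=> e _; apply: hB2.
  have [d0 d0B] := block_has_dart (b0 : block B0).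
  have L e : e \in A'.2 -> linked (remove (whole G) [set u]) (inr d0) (inr e).
    by case/hd=> B1 [b1 s1 e1]; apply: (subtree_linked_off b0 u0 s0 b1 s1 c0 d0B e1).
  have sub2 e : e \in A'.2 -> e \in B'.2.
    move=> eA; have : linked (remove (whole G) [set u]) (inr d) (inr e).
      by apply: (linked_trans (y := inr d0)); [rewrite linkedC; apply: L|apply: L].
    by case/(interior_transfer bA' bB' (x := inr d) (y := inr e) dA' dB')/andP.
  apply/andP; split; apply/subsetP; last exact: sub2.
  move=> w /(block_part_dart pA')[e eA ew].
  by have [_] := boundary_closed bB' (sub2 e eA); apply.
case: (pA) => n [[bn nc hv hd] [_ att]]; case: (pB) => n' [[bn' nc' hv' hd'] [_ att']].
case: n bn att hv hd {nc} => [w|B0] bn att hv hd.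
  case: n' bn' att' hv' hd' {nc'} => [w'|B0] bn' att' hv' hd'.
    have E : w = w' by rewrite -att -att'.
    subst w'; apply: in_sub_eq => -[t|t] /=; apply/idP/idP.
    - by move/hv/hv'.
    - by move/hv'/hv.
    - by move/hd/hd'.
    - by move/hd'/hd.
  apply/esym/mA; first by apply: Or31; exists u.
  exact: (incl B A B0).
apply/mB; first by apply: Or31; exists u.
exact: (incl A B B0).
Qed.

(** A proper atom meeting a block atom would force a two-element boundary into a singleton. Two
    proper atoms contain each other's interiors and boundaries. *)
Lemma atoms_disjoint A B d : atom c A -> atom c B -> d \in A.2 -> d \in B.2 -> A = B.
Proof.
move=> aA aB dA dB; have [U bA] := atom_boundary aA; have [W bB] := atom_boundary aB.
have set2_1 (u v w : V) : u <> v -> ~~ ([set u; v] \subset [set w]).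
  by move=> /eqP uv; apply/negP => /subset_leq_card; rewrite cards1 cards2 uv.
case/boundaryP: (bA) => _ [[u EU pA]|[u [v [EU pA]]]|[u [v [EU pA]]]]; subst U; last first.
- exact: dipole_disjoint pA bA bB dA dB.
- case/boundaryP: (bB) => _ [[u' EU pB]|[u' [v' [EU pB]]]|[u' [v' [EU pB]]]]; subst W.
  + have [_] := proper_disjoint pA bA bB dA dB; have [K [[_ uv _ _] _]] := proper_partP pA.
    by rewrite (negPf (set2_1 _ _ _ uv)).
  + have [h s1] := proper_disjoint pA bA bB dA dB.
    have [h' s2] := proper_disjoint pB bB bA dB dA.
    have E : [set u; v] = [set u'; v'] by apply/eqP; rewrite eqEsubset s1.
    apply: in_sub_eq => -[t|t]; last by apply/idP/idP => [/(h (inr t))|/(h' (inr t))].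
    have sA w : w \in [set u; v] -> w \in A.1 by apply: boundary_sub bA.
    have sB w : w \in [set u'; v'] -> w \in B.1 by apply: boundary_sub bB.
    apply/idP/idP => /= tA; case: (boolP (t \in [set u; v])) => tU.
    * by apply: sB; rewrite -E.
    * by have := h (inl t); rewrite /= !inE in tU *; rewrite tU tA => /(_ isT) /andP[].
    * exact: sA.
    * rewrite E in tU; have := h' (inl t); rewrite /= !inE in tU *; rewrite tU tA.
      by move=> /(_ isT) /andP[].
  + exact/esym/(dipole_disjoint pB bB bA dB dA).
case/boundaryP: (bB) => _ [[u' EU pB]|[u' [v' [EU pB]]]|[u' [v' [EU pB]]]]; subst W.
- exact: block_disjoint pA bA pB bB dA dB.
- have [_] := proper_disjoint pB bB bA dB dA; have [K [[_ uv _ _] _]] := proper_partP pB.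
  by rewrite (negPf (set2_1 _ _ _ uv)).
exact/esym/(dipole_disjoint pB bB bA dB dA).
Qed.

Lemma atoms_disjoint_vert A U B W v : boundary c A U -> boundary c B W ->
  v \in A.1 :\: U -> v \in B.1 :\: W -> A = B.
Proof.
move=> bA bB; rewrite !inE => /andP[_ vA] /andP[vW vB].
have [d dA dv] := boundary_dart bA vA.
have aA : atom c A by case/boundaryP: bA.
have aB : atom c B by case/boundaryP: bB.
exact: atoms_disjoint aA aB dA (boundary_star bB vB vW dv).
Qed.

End Disjointness.

Lemma set2_eq (T : finType) (u v u' v' : T) : [set u; v] = [set u'; v'] ->
  (u' = u /\ v' = v) \/ (u' = v /\ v' = u).
Proof.
move=> E; have : (u \in [set u'; v']) && (v \in [set u'; v']) by rewrite -E !inE !eqxx orbT.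
have : (u' \in [set u; v]) && (v' \in [set u; v]) by rewrite E !inE !eqxx orbT.
rewrite !inE => /andP[/orP[] /eqP h /orP[] /eqP k] /andP[/orP[] /eqP h' /orP[] /eqP k'];
  subst; auto.
Qed.

(** * One reduction step: the new edges, and connectedness of the reduced graph *)

Section Reduction.

Variables (G G' : rooted_graph) (R : reduction G G').
Local Notation c := (Defs.root G).
Hypothesis Gconn : connected (whole G).
Implicit Types (A B : subgraph G) (U W : {set vert G}).

Lemma rv_not_interior v' : ~ interior_vert c (rv R v').
Proof. by apply/(rv_range R); exists v'. Qed.

Lemma rd_valid d' : valid_origin (rd R d').
Proof. by apply/(rd_range R); exists d'. Qed.

Lemma boundary_dart_new A U u : boundary c A U -> u \in U ->
  exists d' u', [/\ rd R d' = inr (A, Some u), inc d' = Some u' & rv R u' = u].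
Proof.
move=> bA uU.
have [d' E] : exists d', rd R d' = inr (A, Some u) by apply/rd_range; exists U.
exists d'; have := red_inc R d'; rewrite E.
by case: (inc d') => // u' [<-]; exists u'.
Qed.

Lemma boundary_not_interior A U u : boundary c A U -> u \in U -> ~ interior_vert c u.
Proof.
by move=> bA uU; have [d' [u' [_ _ <-]]] := boundary_dart_new bA uU; apply: rv_not_interior.
Qed.

Let buniq := boundary_uniq Gconn boundary_not_interior.
Let disj := atoms_disjoint Gconn boundary_not_interior.

Lemma two_atom_neq A u v : two_atom c A u v -> u <> v.
Proof.
case=> _ [/proper_partP[K [[_ //]]]|[/eqP //]].
Qed.

Lemma boundary_atom A U : boundary c A U -> atom c A.
Proof. by case/boundaryP. Qed.

Lemma boundary_neq0 A U : boundary c A U -> exists u, u \in U.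
Proof. by case=> [[u _ ->]|[u [v [_ ->]]]]; exists u; rewrite !inE eqxx. Qed.

Lemma block_atom_boundary A u : block_atom c A u -> boundary c A [set u].
Proof. by left; exists u. Qed.

Lemma two_atom_boundary A u v : two_atom c A u v -> boundary c A [set u; v].
Proof. by right; exists u, v. Qed.

Lemma block_two_atom A u v w : two_atom c A u v -> ~ block_atom c A w.
Proof.
move=> tA bA; have := buniq (two_atom_boundary tA) (block_atom_boundary bA).
by move/(congr1 (fun X : {set _} => #|X|)); rewrite cards1 cards2; have /eqP -> := two_atom_neq tA.
Qed.

Lemma valid_new A o : valid_origin (inr (A, o) : origin G) -> exists2 U, boundary c A U &
  match o with Some u => u \in U | None => exists2 u, block_atom c A u & U = [set u] end.
Proof.
case: o => [u [U bA uU]|[u bA]]; first by exists U.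
by exists [set u]; [exact: block_atom_boundary|exists u].
Qed.

Lemma rd_new_atom d' A o : rd R d' = inr (A, o) -> atom c A.
Proof.
move=> E; have := rd_valid d'; rewrite E => /valid_new[U bA _]; exact: boundary_atom bA.
Qed.

(* The edge e_A has exactly two darts. *)
Lemma other_end_uniq A o o1 o2 : valid_origin (inr (A, o) : origin G) ->
  valid_origin (inr (A, o1) : origin G) -> valid_origin (inr (A, o2) : origin G) ->
  o1 <> o -> o2 <> o -> o1 = o2.
Proof.
case/valid_new=> U bA hU /valid_new[U1 bA1 hU1] /valid_new[U2 bA2 hU2].
have ? := buniq bA bA1; have ? := buniq bA bA2; subst U1 U2.
case: (bA) => [[u uA EU]|[u [v [tA EU]]]].
  subst U; case: o o1 o2 hU hU1 hU2 => [a|] [a1|] [a2|] //; rewrite !inE.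
  - by move=> /eqP-> /eqP->.
  - by move=> /eqP-> /eqP->.
  - by move=> /eqP-> _ /eqP->.
  - by move=> _ /eqP-> /eqP->.
have nN : ~ exists2 w, block_atom c A w & U = [set w].
  by case=> w bw _; apply: block_two_atom tA bw.
subst U; case: o o1 o2 hU hU1 hU2 => [a|] [a1|] [a2|] //; rewrite !inE.
by do 3 (case/orP=> /eqP ->).
Qed.

Lemma rd_inv_new d' A o o1 : rd R d' = inr (A, o) -> valid_origin (inr (A, o1) : origin G) ->
  o1 <> o -> rd R (inv d') = inr (A, o1).
Proof.
move=> E v1 n1; have [o2 n2 E2] := red_inv_new E.
rewrite E2; congr inr; congr pair.
by apply: (other_end_uniq (A := A) (o := o)) => //; [rewrite -E|rewrite -E2]; apply: rd_valid.
Qed.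

Lemma rd_same_atom d1 d2 A o1 o2 : rd R d1 = inr (A, o1) -> rd R d2 = inr (A, o2) ->
  d2 = d1 \/ d2 = inv d1.
Proof.
move=> E1 E2; case: (eqVneq o2 o1) => [E|/eqP n]; [left|right]; apply: (rd_inj (r := R)).
  by rewrite E1 E2 E.
by rewrite E2 (rd_inv_new E1 _ n) // -E2; apply: rd_valid.
Qed.

Lemma interior_old_dart d d' : rd R d' = inl d -> ~ interior_dart c d.
Proof. by move=> E; have := rd_valid d'; rewrite E. Qed.

Lemma old_dart d : ~ interior_dart c d -> exists d', rd R d' = inl d.
Proof. by move=> h; apply/rd_range. Qed.

Lemma old_vert v : ~ interior_vert c v -> exists v', rv R v' = v.
Proof. by move/(rv_range R). Qed.

(** * The reduced graph is connected *)

(** A relation rather than a map: an interior vertex or dart corresponds to either dart of e_A, and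
    the choice is immaterial because the two are linked. *)
Definition image_of (x : vert G + dart G) (x' : vert G' + dart G') :=
  match x, x' with
  | inl v, inl v' => rv R v' = v
  | inl v, inr d' => exists A U o, [/\ boundary c A U, v \in A.1 :\: U & rd R d' = inr (A, o)]
  | inr d, inr d' => rd R d' = inl d \/ exists A o, d \in A.2 /\ rd R d' = inr (A, o)
  | inr _, inl _ => False
  end.

Lemma linked_same_atom d1 d2 A o1 o2 : rd R d1 = inr (A, o1) -> rd R d2 = inr (A, o2) ->
  linked (whole G') (inr d1) (inr d2).
Proof.
move=> E1 E2; case: (rd_same_atom E1 E2) => ->; first exact: connect0.
by apply: linked1; rewrite /= ?inE.
Qed.

Lemma image_of_linked x x' y' : image_of x x' -> image_of x y' -> linked (whole G') x' y'.
Proof.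
case: x x' y' => [v|d] [v1|d1] [v2|d2] //=.
- by move=> <- /(rv_inj) ->; apply: connect0.
- move=> E [A [U [o [bA vA _]]]]; case: (@rv_not_interior v1); exists A, U; by rewrite E.
- move=> [A [U [o [bA vA _]]]] E; case: (@rv_not_interior v2); exists A, U; by rewrite E.
- move=> [A [U [o [bA vA E1]]]] [B [W [o2 [bB vB E2]]]].
  have EAB := atoms_disjoint_vert Gconn boundary_not_interior bA bB vA vB; subst B.
  exact: linked_same_atom E1 E2.
have no d0 e A o : rd R e = inl d0 -> d0 \in A.2 -> rd R d1 = inr (A, o) \/ rd R d2 = inr (A, o) -> False.
  move=> E dA h; apply: (interior_old_dart E); exists A; split=> //.
  by case: h => /rd_new_atom.
case=> [E1|[A [o [dA E1]]]] [E2|[B [o2 [dB E2]]]].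
- by rewrite (rd_inj (etrans E1 (esym E2))); apply: connect0.
- by case: (no d d1 B o2 E1 dB); right.
- by case: (no d d2 A o E2 dA); left.
have EAB := disj (rd_new_atom E1) (rd_new_atom E2) dA dB; subst B.
exact: linked_same_atom E1 E2.
Qed.

Lemma image_of_touch x y : touch x y ->
  exists x' y', [/\ image_of x x', image_of y y' & linked (whole G') x' y'].
Proof.
have inc_case v d : inc d = Some v ->
    exists x' y', [/\ image_of (inl v) x', image_of (inr d) y' & linked (whole G') x' y'].
  move=> dv; case: (classic (interior_dart c d)) => [[A [aA dA]]|nd].
    have [U bA] := atom_boundary aA; have [_ /(_ v dv) vA] := boundary_closed bA dA.
    case: (boolP (v \in U)) => vU.
      have [d' [u' [E iE rE]]] := boundary_dart_new bA vU.
      exists (inl u'), (inr d'); split=> //; first by right; exists A, (Some v).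
      by apply: linked1; rewrite /= ?inE ?iE.
    have [u uU] := boundary_neq0 bA; have [d' [u' [E _ _]]] := boundary_dart_new bA uU.
    exists (inr d'), (inr d'); split; last exact: connect0.
      by exists A, U, (Some u); rewrite inE vU vA.
    by right; exists A, (Some u).
  have [d' E] := old_dart nd; have := red_inc R d'; rewrite E dv.
  case iE: (inc d') => [v'|] // [vE]; exists (inl v'), (inr d'); split=> //; first by left.
  by apply: linked1; rewrite /= ?inE ?iE.
case: x y => [v|d] [w|e] //= /eqP E.
- exact: inc_case.
- by have [x' [y' [h1 h2 h3]]] := inc_case _ _ E; exists y', x'; rewrite linkedC.
subst e; case: (classic (interior_dart c d)) => [[A [aA dA]]|nd].
  have [U bA] := atom_boundary aA; have [iA _] := boundary_closed bA dA.
  have [u uU] := boundary_neq0 bA; have [d' [u' [E _ _]]] := boundary_dart_new bA uU.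
  by exists (inr d'), (inr d'); split; [right; exists A, (Some u)|right; exists A, (Some u)|exact: connect0].
have [d' E] := old_dart nd; exists (inr d'), (inr (inv d')); split; [by left|left; exact: red_inv_old|].
by apply: linked1; rewrite /= ?inE.
Qed.

Lemma reduced_connected : connected (whole G').
Proof.
have toG x' : exists x, image_of x x'.
  case: x' => [v'|d']; first by exists (inl (rv R v')).
  case E: (rd R d') => [d|[A o]]; first by exists (inr d); left.
  have [U bA] := atom_boundary (rd_new_atom E); have [u uU] := boundary_neq0 bA.
  have [d dA _] := boundary_dart bA (boundary_sub Gconn bA uU).
  by exists (inr d); right; exists A, o.
apply/connectedP => x' y' _ _; have [x xx'] := toG x'; have [y yy'] := toG y'.
have xy := linked_whole Gconn x y.
move: y' yy'.
(* The claim covers all images of [y], since consecutive steps of the walk may select different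
   ones. *)
apply: (linked_ind_step (P := fun y => forall y', image_of y y' -> linked (whole G') x' y') xy).
  by move=> z; apply: image_of_linked.
move=> a b _ _ ab Pa b' bb'; have [a1 [b1 [h1 h2 h3]]] := image_of_touch ab.
apply: linked_trans (Pa a1 h1) _; apply: linked_trans h3 _.
exact: image_of_linked h2 bb'.
Qed.

End Reduction.

Lemma exchangesC (G : graph) (s : {perm vert G} * {perm dart G}) u v :
  exchanges s u v -> exchanges s v u.
Proof. by case. Qed.

Lemma halvable_boundary_eq (G : graph) (A : subgraph G) u v u' v' : [set u; v] = [set u'; v'] ->
  halvable_boundary A u v -> halvable_boundary A u' v'.
Proof.
move=> E [s sA [o2 sr ex]]; exists s; first by rewrite -E.
by split=> //; case: (set2_eq E) => -[-> ->] //; apply: exchangesC.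
Qed.

Lemma exchangeable_boundary_eq (G : graph) (A : subgraph G) u v u' v' :
  [set u; v] = [set u'; v'] ->
  exchangeable_boundary A u v -> exchangeable_boundary A u' v'.
Proof.
move=> E [s sA ex]; exists s; first by rewrite -E.
by case: (set2_eq E) => -[-> ->] //; apply: exchangesC.
Qed.

Lemma halvable_exchangeable (G : graph) (A : subgraph G) u v :
  halvable_boundary A u v -> exchangeable_boundary A u v.
Proof. by case=> s sA [_ _ ex]; exists s. Qed.

(** * Inducing automorphisms on the reduced graph, and lifting them back *)

Section Induced.

Variables (G G' : rooted_graph) (R : reduction G G').
Local Notation c := (Defs.root G).
Hypothesis Gconn : connected (whole G).
Hypothesis fixc : forall p, p \in AutG G -> act_node p c = c.
Implicit Types (A B : subgraph G) (U W : {set vert G}).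

Let buniq := boundary_uniq Gconn (boundary_not_interior R).
Let disj := atoms_disjoint Gconn (boundary_not_interior R).

Lemma two_atom_set_eq A u v u' v' : two_atom c A u v -> two_atom c A u' v' ->
  [set u; v] = [set u'; v'].
Proof. move=> tA tA'; exact: (buniq (two_atom_boundary tA) (two_atom_boundary tA')). Qed.

(** The types refer to some ordered pair of boundary vertices. The boundary set is unique, and both
    exchange properties depend only on the unordered pair. *)
Lemma replacing_type_uniq A t t' : replacing_type c A t -> replacing_type c A t' -> t = t'.
Proof.
have HU A0 : replacing_type c A0 Halvable -> ~ replacing_type c A0 Undirected.
  move=> [u [v [tA h]]] [[w bA]|[u' [v' [tA' nh _]]]]; first exact: (block_two_atom R Gconn tA bA).
  by apply: nh; apply: halvable_boundary_eq h; apply: two_atom_set_eq tA tA'.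
have HD A0 : replacing_type c A0 Halvable -> ~ replacing_type c A0 Directed.
  move=> [u [v [tA h]]] [u' [v' [tA' nh _]]].
  by apply: nh; apply: halvable_boundary_eq h; apply: two_atom_set_eq tA tA'.
have UD A0 : replacing_type c A0 Undirected -> ~ replacing_type c A0 Directed.
  move=> [[w bA]|[u [v [tA _ h]]]] [u' [v' [tA' _ nh]]]; first exact: (block_two_atom R Gconn tA' bA).
  by apply: nh; apply: exchangeable_boundary_eq h; apply: two_atom_set_eq tA tA'.
by case: t; case: t' => // h k; [case: (HU A)|case: (HD A)|case: (HU A)|case: (UD A)|case: (HD A)|case: (UD A)].
Qed.

Lemma origin_map_new p A o :
  origin_map p (inr (A, o) : origin G) = inr (act_sub p A, omap p.1 o).
Proof. by []. Qed.

Lemma origin_map_valid p (x : origin G) : p \in AutG G -> valid_origin x ->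
  valid_origin (origin_map p x).
Proof.
move=> ap; case: x => [d|[A [u|]]] /=.
- by move=> h /(act_interior_dart fixc (autV ap)); rewrite /= permK.
- case=> U bA uU; exists (p.1 @: U); first exact: (act_boundary fixc ap bA).
  exact: imset_f.
by case=> u bA; exists (p.1 u); apply: (act_block_atom fixc ap bA).
Qed.

Lemma origin_map_inj p : injective (@origin_map G p).
Proof.
move=> [d|[A o]] [e|[B o']] //; first by case=> /perm_inj ->.
rewrite !origin_map_new => -[E1 E2 E3].
have -> : A = B by apply: (can_inj (act_subK p)); rewrite /act_sub E1 E2.
by congr (inr (_, _)); move: E3; case: o o' => [u|] [u'|] // [/perm_inj ->].
Qed.

Lemma origin_map_inc p (x : origin G) : p \in AutG G ->
  match origin_map p x with inl d => inc d | inr (_, o) => o end =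
  omap p.1 (match x with inl d => inc d | inr (_, o) => o end).
Proof. by move=> ap; case: x => [d|[A o]] //=; apply: act_inc. Qed.

(** Old edges inherit everything from [p]. On a new edge, [p] is itself a boundary isomorphism from
    [A] onto the image atom, which settles color and orientation through [red_color_class] and
    [red_pos_new]; the type is transported and unique. *)
Lemma induced_aut p q : p \in AutG G -> induced R p q -> q \in AutG G'.
Proof.
move=> ap [hv hd]; apply/autP => d'.
have Einc : inc (q.2 d') = omap q.1 (inc d').
  have : omap (rv R) (inc (q.2 d')) = omap (rv R) (omap q.1 (inc d')).
    rewrite (red_inc R) hd origin_map_inc // -(red_inc R).
    by case: (inc d') => //= v'; rewrite hv.
  by case: (inc (q.2 d')) (omap q.1 (inc d')) => [a|] [b|] //= [/rv_inj ->].
rewrite /preserves Einc eqxx /=.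
case E: (rd R d') => [d|[A o]]; have := hd d'; rewrite E => Eq.
  have Eq' : rd R (q.2 d') = inl (p.2 d) by [].
  have /autP/(_ d)/and5P[_ /eqP pi /eqP pc /eqP pk /implyP pp] := ap.
  rewrite (red_color_old Eq') (red_color_old E) pc eqxx.
  rewrite (red_kind_old Eq') (red_kind_old E) pk eqxx.
  rewrite (red_pos_old Eq') (red_pos_old E); apply/andP; split.
    apply/eqP/(rd_inj (r := R)); rewrite hd (red_inv_old Eq') (red_inv_old E) /=.
    by rewrite pi.
  by apply/implyP => /pp.
rewrite origin_map_new in Eq; have aA := rd_new_atom E.
have [U bA] := atom_boundary aA.
have [o1 n1 E1] := red_inv_new E.
have Hk : replacing_type c A (kind d') := red_kind_new E.
have Hk' : kind (q.2 d') = kind d'.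
  apply: replacing_type_uniq (red_kind_new Eq) _; exact: (act_replacing_type fixc ap Hk).
apply/and4P; split.
- apply/eqP/(rd_inj (r := R)); rewrite hd E1 origin_map_new.
  apply: (rd_inv_new Gconn Eq).
    by rewrite -origin_map_new -E1; apply: origin_map_valid => //; apply: rd_valid.
  by case: o o1 n1 {E Eq E1} => [u|] [u1|] //= n1 [/perm_inj h]; apply: n1; rewrite h.
- apply/eqP; symmetry; apply/(red_color_class E Eq); exists p.1, p.2.
  exact: (act_boundary_iso fixc ap bA).
- by rewrite Hk'.
apply/implyP => /eqP kD; rewrite kD in Hk.
case: o E Eq {n1 E1} => [u|] E Eq.
  apply/eqP; symmetry; apply: (red_pos_new (f := p.1) (g := p.2) E Eq Hk).
  exact: (act_boundary_iso fixc ap bA).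
(* A new dart without end-vertex comes from a block atom, whose edge is undirected. *)
have [u bu] : exists u, block_atom c A u by have := rd_valid R d'; rewrite E.
by have := replacing_type_uniq Hk (t' := Undirected) (or_introl (ex_intro _ u bu)).
Qed.

Lemma induced_exists p : p \in AutG G -> exists q, q \in AutG G' /\ induced R p q.
Proof.
move=> ap.
have [f fP] : exists f : vert G' -> vert G', forall v', rv R (f v') = p.1 (rv R v').
  apply: (functional_choice (fun v' w => rv R w = _)) => v'; apply/(rv_range R) => /(act_interior_vert fixc (autV ap)).
  by rewrite /= permK; apply: rv_not_interior.
have [g gP] : exists g : dart G' -> dart G', forall d', rd R (g d') = origin_map p (rd R d').
  apply: (functional_choice (fun d' e => rd R e = _)) => d'; apply/rd_range/origin_map_valid => //; apply: rd_valid.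
have fI : injective f.
  by move=> v1 v2 E; apply/(rv_inj (r := R))/(@perm_inj _ p.1); rewrite -!fP E.
have gI : injective g.
  by move=> d1 d2 E; apply/(rd_inj (r := R))/(@origin_map_inj p); rewrite -!gP E.
have I : induced R p (perm fI, perm gI) by split=> t; rewrite /= permE.
by exists (perm fI, perm gI); split=> //; apply: induced_aut I.
Qed.

Lemma induced_uniq p q q' : induced R p q -> induced R p q' -> q = q'.
Proof.
case: q q' => [q1 q2] [q1' q2'] [h k] [h' k']; congr pair; apply/permP => t.
  by apply: (rv_inj (r := R)); rewrite (h t) (h' t).
by apply: (rd_inj (r := R)); rewrite (k t) (k' t).
Qed.

Lemma induced_mul p q p' q' : induced R p q -> induced R p' q' ->
  induced R (p * p')%g (q * q')%g.
Proof.
move=> [h k] [h' k']; split=> t; rewrite /= !permM ?h' ?h //.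
rewrite k' k; case: (rd R t) => [d|[A o]] //=; first by rewrite permM.
congr (inr (_, _)); last by case: o => //= u; rewrite permM.
by congr pair; rewrite -imset_comp; apply: eq_imset => u; rewrite /= permM.
Qed.

(** * Lifting automorphisms of the reduced graph *)

Lemma sub_iso_comp A B f g (s : {perm vert G} * {perm dart G}) :
  sub_iso A B f g -> s \in aut_set A -> sub_iso A B (f \o s.1) (g \o s.2).
Proof.
case=> fI gI fA gA pr; rewrite inE => /and3P[s1 s2 /forall_inP sp].
have s1A v : v \in A.1 -> s.1 v \in A.1 by move=> vA; rewrite (perm_closed _ s1).
have s2A d : d \in A.2 -> s.2 d \in A.2 by move=> dA; rewrite (perm_closed _ s2).
split.
- by move=> u v uA vA /= /(fI _ _ (s1A _ uA) (s1A _ vA)) /perm_inj.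
- by move=> u v uA vA /= /(gI _ _ (s2A _ uA) (s2A _ vA)) /perm_inj.
- by rewrite imset_comp (im_perm_on s1).
- by rewrite imset_comp (im_perm_on s2).
move=> d dA; have /and5P[/eqP a1 /eqP a2 /eqP a3 /eqP a4 /implyP a5] := sp d dA.
have /and5P[/eqP b1 /eqP b2 /eqP b3 /eqP b4 /implyP b5] := pr _ (s2A _ dA).
rewrite /preserves /= b1 a1 b2 a2 b3 a3 b4 a4 !eqxx /= andbC; apply/andP; split.
  by apply/implyP => k; rewrite (eqP (b5 _)) ?a4 //; exact: a5.
by case: (inc d).
Qed.

(** The last clause ties the lift to [q]: it forces the values of [f] on the boundary, so that lifts
    of atoms sharing a boundary vertex agree there. *)
Definition atom_lift (q : {perm vert G'} * {perm dart G'}) A B f g :=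
  [/\ sub_iso A B f g, atom c B, forall U, boundary c A U -> boundary c B (f @: U) &
      forall d' o, rd R d' = inr (A, o) -> rd R (q.2 d') = inr (B, omap f o)].

(** The colors of new edges differ from all colors of [G], so an automorphism cannot send a new edge
    to an old one. *)
Lemma aut_new_dart q d' A o : q \in AutG G' -> rd R d' = inr (A, o) ->
  exists B o', rd R (q.2 d') = inr (B, o').
Proof.
move=> aq E; have /autP/(_ d')/preserves_color C := aq.
case Eq: (rd R (q.2 d')) => [e|[B o']]; last by exists B, o'.
by case: (red_color_new E (d := e)); rewrite -C (red_color_old Eq).
Qed.

(** A halvable atom is exchangeable in particular, so lacking an exchange supplies both negations
    required for [Directed]. *)
Lemma atom_exchange A u v : two_atom c A u v -> ~ replacing_type c A Directed ->
  exists2 s, s \in aut_set A & exchanges s u v.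
Proof.
move=> tA nD; apply: NNPP => ns; apply: nD; exists u, v.
have ne : ~ exchangeable_boundary A u v.
  by case=> s; rewrite inE => /andP[sA _] ex; apply: ns; exists s.
by split=> // /halvable_exchangeable.
Qed.

Lemma atom_lift_exists q A : q \in AutG G' -> atom c A -> exists B f g, atom_lift q A B f g.
Proof.
move=> aq aA; have [U bA] := atom_boundary aA.
have /autP aq' := aq.
(* One dart of e_A decides: [q] commutes with the involution, so once [f] is right at [u], the other
   dart goes to the other dart of e_B. The last premise says that [f] matches the remaining end. *)
have lift_of u d1 B f g o' : u \in U -> rd R d1 = inr (A, Some u) -> rd R (q.2 d1) = inr (B, o') ->
    sub_iso A B f g -> boundary c B (f @: U) -> o' = Some (f u) ->
    (forall w, w \in f @: U -> w <> f u -> forall o, valid_origin (inr (A, o) : origin G) ->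
        o <> Some u -> Some w = omap f o) ->
    atom_lift q A B f g.
  move=> uU E1 Eq iso bB Eo hw.
  have aB : atom c B := boundary_atom bB.
  split=> //; first by move=> U' bA'; rewrite -(buniq bA bA').
  move=> d' o E; case: (rd_same_atom Gconn E1 E) => Ed.
    by move: E; rewrite Ed E1 => -[<-]; rewrite Eq Eo.
  have Eqi : q.2 d' = inv (q.2 d1) by rewrite Ed (preserves_inv (aq' _)).
  have [o2 n2 E2] := red_inv_new Eq; rewrite Eqi E2; congr (inr (_, _)).
  have no : o <> Some u.
    have [o3 n3 E3] := red_inv_new E1; move: E3; rewrite -Ed E => -[->]; exact: n3.
  have vo : valid_origin (inr (A, o) : origin G) by rewrite -E; apply: rd_valid.
  have : valid_origin (inr (B, o2) : origin G) by rewrite -E2; apply: rd_valid.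
  case/valid_new=> W bB2; rewrite -(buniq bB bB2).
  case: o2 n2 E2 => [w|] n2 E2; first by move=> wW; apply: hw => // Ew; apply: n2; rewrite Eo Ew.
  (* The image edge is pendant. As [f] is injective on the boundary, [A] is a block atom too, and
     both remaining darts have no end-vertex. *)
  case=> w bw Ew; case: (bA) => [[x bx EU]|[x [y [tA EU]]]].
    case/valid_new: vo => U' bU'; rewrite -(buniq bA bU') EU.
    case: o no {E} => // x' no; rewrite inE => /eqP xx; case: no.
    by rewrite xx; move: uU; rewrite EU inE => /eqP ->.
  have fx : f x = f y.
    have : (f x \in [set w]) && (f y \in [set w]) by rewrite -Ew !imset_f // EU !inE eqxx ?orbT.
    by rewrite !inE => /andP[/eqP -> /eqP ->].
  case: iso => fI _ _ _ _; case: (two_atom_neq tA); apply: fI fx.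
    by apply: (boundary_sub Gconn bA); rewrite EU !inE eqxx.
  by apply: (boundary_sub Gconn bA); rewrite EU !inE eqxx orbT.
have [u uU] := boundary_neq0 bA.
have [d1 [u' [E1 iE rE]]] := boundary_dart_new R bA uU.
have [B [o' Eq]] := aut_new_dart aq E1.
have C := preserves_color (aq' d1).
have [f [g [iso [U0 [W [bA0 bB fU]]]]]] : exists f g, boundary_iso c A B f g.
  by apply/(red_color_class E1 Eq); rewrite C.
have EU0 := buniq bA bA0; subst U0 W.
(* [d1] has an end-vertex and [q] preserves incidence, so the image dart sits at a boundary vertex
   of [B], though possibly not at [f u]. *)
have Uo' : exists2 w, o' = Some w & w \in f @: U.
  have := red_inc R (q.2 d1); rewrite Eq (preserves_inc (aq' d1)) iE /= => Ew.
  have := rd_valid R (q.2 d1); rewrite Eq -Ew => -[W bW wW].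
  by exists (rv R (q.1 u')); rewrite // (buniq bB bW).
case: Uo' => w Eo wU; subst o'.
case: (bA) => [[x bx EU]|[x [y [tA EU]]]].
  have Ex : x = u by move: uU; rewrite EU inE => /eqP.
  subst x; exists B, f, g; apply: (lift_of u d1 B f g _ uU E1 Eq iso bB).
    by move: wU; rewrite EU imset_set1 inE => /eqP ->.
  by move=> w'; rewrite EU imset_set1 inE => /eqP ->.
have [v [EUv uv xyuv]] : exists v, [/\ U = [set u; v], u <> v &
    forall s : {perm vert G} * {perm dart G}, exchanges s x y -> exchanges s u v].
  have xy := two_atom_neq tA.
  move: uU; rewrite EU !inE => /orP[] /eqP ->; first by exists y.
  exists x; split; [exact: setUC|by move=> E; apply: xy|move=> s; exact: exchangesC].
have fUE : f @: U = [set f u; f v] by rewrite EUv imsetU1 imset_set1.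
have other (h : vert G -> vert G) : h @: U = [set h u; h v] -> 
    forall w', w' \in h @: U -> w' <> h u -> forall o, valid_origin (inr (A, o) : origin G) ->
    o <> Some u -> Some w' = omap h o.
  move=> hE w'; rewrite hE !inE => /orP[/eqP -> //|/eqP -> _] o vo no.
  case/valid_new: vo => U' bU'; rewrite -(buniq bA bU').
  case: o no => [z|] no; last by case=> z bz _; case: (block_two_atom R Gconn tA bz).
  by rewrite EUv !inE => /orP[] /eqP Ez; [case: no; rewrite Ez|rewrite Ez].
case: (eqVneq w (f u)) => [Ew|/eqP Ew].
  by exists B, f, g; apply: (lift_of u d1 B f g _ uU E1 Eq iso bB); [rewrite Ew|apply: other].
have wv : w = f v by move: wU; rewrite fUE !inE => /orP[/eqP //|/eqP].
(* Wrong direction: an automorphism of [A] exchanging [u] and [v], composed before [f] and [g],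
   repairs it. *)
have [s sA [su sv]] : exists2 s, s \in aut_set A & exchanges s u v.
  suff nD : ~ replacing_type c A Directed.
    by have [s sA /xyuv ex] := atom_exchange tA nD; exists s.
  (* For a directed edge, [red_pos_new] would give [d1] and [inv (q.2 d1)] the same sign, whereas
     [q] preserves signs and the involution flips them. *)
  move=> tD.
  have kD : kind d1 = Directed by apply: replacing_type_uniq (red_kind_new E1) tD.
  have E2 : rd R (inv (q.2 d1)) = inr (B, Some (f u)).
    apply: (rd_inv_new Gconn Eq); last by case=> h; apply: Ew.
    by exists (f @: U) => //; apply: imset_f.
  have : pos d1 = pos (inv (q.2 d1)).
    by apply: (red_pos_new (g := g) E1 E2 tD); split=> //; exists U, (f @: U).
  have /and5P[_ _ _ /eqP kq /implyP pq] := aq' d1.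
  rewrite pos_inv ?kq // (eqP (pq _)) ?kD //; by case: (pos d1).
exists B, (f \o s.1), (g \o s.2).
have sU : (f \o s.1) @: U = f @: U.
  by rewrite fUE EUv imsetU1 imset_set1 /= su sv setUC.
apply: (lift_of u d1 B _ _ _ uU E1 Eq); rewrite ?sU //=.
- exact: sub_iso_comp.
- by rewrite wv su.
by have := other (f \o s.1); rewrite sU; apply; rewrite fUE /= su sv setUC.
Qed.

(** If two atoms had the same target, a dart of each new edge would be sent by [q] to the same dart
    of e_B; injectivity of [q] identifies them. *)
Lemma atom_lift_inj q A1 A2 B f1 g1 f2 g2 : atom c A1 -> atom c A2 ->
  atom_lift q A1 B f1 g1 -> atom_lift q A2 B f2 g2 -> A1 = A2.
Proof.
move=> a1 a2 [_ _ b1 r1] [_ _ b2 r2].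
have [U1 bU1] := atom_boundary a1; have [U2 bU2] := atom_boundary a2.
have [u1 uU1] := boundary_neq0 bU1.
have : f1 u1 \in f2 @: U2 by rewrite (buniq (b2 _ bU2) (b1 _ bU1)) imset_f.
case/imsetP=> u2 uU2 Ef.
have [d1 [_ [E1 _ _]]] := boundary_dart_new R bU1 uU1.
have [d2 [_ [E2 _ _]]] := boundary_dart_new R bU2 uU2.
have : q.2 d1 = q.2 d2.
  by apply: (rd_inj (r := R)); rewrite (r1 _ _ E1) (r2 _ _ E2) /= Ef.
by move/perm_inj => Ed; move: E1; rewrite Ed E2 => -[].
Qed.

Lemma atom_lift_boundary q A B f g U u u' : boundary c A U -> u \in U ->
  q \in AutG G' -> atom_lift q A B f g -> rv R u' = u -> f u = rv R (q.1 u').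
Proof.
move=> bA uU /autP aq [_ _ _ lr] Eu'.
have [d [w [E iE rE]]] := boundary_dart_new R bA uU.
have <- : w = u' by apply: (rv_inj (r := R)); rewrite rE.
have := red_inc R (q.2 d); rewrite (lr _ _ E) (preserves_inc (aq d)) iE /=.
by case.
Qed.

Lemma aut_old_dart q d d' : q \in AutG G' -> rd R d' = inl d ->
  exists e, rd R (q.2 d') = inl e.
Proof.
move=> aq E; have /autP/(_ d')/preserves_color C := aq.
case Eq: (rd R (q.2 d')) => [e|[B o']]; first by exists e.
by case: (red_color_new Eq (d := d)); rewrite C (red_color_old E).
Qed.

(** * Gluing the lifts of the atoms to an automorphism *)

Section Glue.

Variables (q : {perm vert G'} * {perm dart G'}) (autq : q \in AutG G').
Variables (tgt : subgraph G -> subgraph G) (fV : subgraph G -> vert G -> vert G)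
  (fD : subgraph G -> dart G -> dart G).
Hypothesis lifts : forall A, atom c A -> atom_lift q A (tgt A) (fV A) (fD A).

(** Common vertices follow [q], interior ones follow the lift of their atom, which is unique by
    disjointness. The second clause extends to boundary vertices because the lift takes there the
    values prescribed by [q]. *)
Lemma glue_vert : exists f : vert G -> vert G,
  (forall v', f (rv R v') = rv R (q.1 v')) /\
  (forall A v, atom c A -> v \in A.1 -> f v = fV A v).
Proof.
have [f fP] : exists f : vert G -> vert G, forall v,
    (forall v', rv R v' = v -> f v = rv R (q.1 v')) /\
    (forall A U, boundary c A U -> v \in A.1 :\: U -> f v = fV A v).
  apply: (functional_choice (fun v w => (forall v', rv R v' = v -> w = rv R (q.1 v')) /\
    (forall A U, boundary c A U -> v \in A.1 :\: U -> w = fV A v))) => v.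
  case: (classic (interior_vert c v)) => [[A [U [bA vA]]]|nv].
    exists (fV A v); split=> [v' E|B W bB vB].
      by case: (@rv_not_interior _ _ R v'); rewrite E; exists A, U.
    by rewrite (atoms_disjoint_vert Gconn (boundary_not_interior R) bA bB vA vB).
  have [v' E] := old_vert R nv; exists (rv R (q.1 v')); split=> [w' Ew|A U bA vA].
    by rewrite (rv_inj (etrans Ew (esym E))).
  by case: nv; exists A, U.
exists f; split=> [v'|A v aA vA]; first by apply: (proj1 (fP _)).
have [U bA] := atom_boundary aA; case: (boolP (v \in U)) => vU.
  have [v' Ev] := old_vert R (boundary_not_interior R bA vU).
  by rewrite (proj1 (fP v) v' Ev) (atom_lift_boundary bA vU autq (lifts aA) Ev).
by apply: (proj2 (fP v) A U bA); rewrite inE vU.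
Qed.

Lemma glue_dart : exists g : dart G -> dart G,
  (forall d' d, rd R d' = inl d -> rd R (q.2 d') = inl (g d)) /\
  (forall A d, atom c A -> d \in A.2 -> g d = fD A d).
Proof.
have [g gP] : exists g : dart G -> dart G, forall d,
    (forall d', rd R d' = inl d -> rd R (q.2 d') = inl (g d)) /\
    (forall A, atom c A -> d \in A.2 -> g d = fD A d).
  apply: (functional_choice (fun d e => (forall d', rd R d' = inl d -> rd R (q.2 d') = inl e) /\
    (forall A, atom c A -> d \in A.2 -> e = fD A d))) => d.
  case: (classic (interior_dart c d)) => [[A [aA dA]]|nd].
    exists (fD A d); split=> [d' E|B aB dB].
      by case: (interior_old_dart E); exists A.
    by rewrite (disj aA aB dA dB).
  have [d' E] := old_dart R nd; have [e Ee] := aut_old_dart autq E.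
  exists e; split=> [d2 E2|A aA dA]; first by rewrite (rd_inj (etrans E2 (esym E))).
  by case: nd; exists A.
by exists g; split=> [d' d|A d]; case: (gP d); [move=> h _; apply: h|move=> _; apply].
Qed.

Lemma atom_lift_interior A U v : boundary c A U -> v \in A.1 :\: U ->
  fV A v \in (tgt A).1 :\: fV A @: U.
Proof.
move=> bA; rewrite !inE => /andP[vU vA]; have [[fI _ fA _ _] _ _ _] := lifts (boundary_atom bA).
apply/andP; split; last by rewrite -fA; apply: imset_f.
apply: contra vU => /imsetP[u uU E].
by rewrite (fI _ _ vA (boundary_sub Gconn bA uU) E).
Qed.

(** Interior elements go to interior ones and common elements to common ones, so injectivity can
    only fail within one kind. If two interior images agree, the target atoms meet, hence are equal,
    and so are the source atoms; the lift is injective there. *)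
Lemma glue_exists : exists p, p \in AutG G /\ induced R p q.
Proof.
have [f [fR fA]] := glue_vert; have [g [gR gA]] := glue_dart; have /autP aq := autq.
have tgt_inj A B : atom c A -> atom c B -> tgt A = tgt B -> A = B.
  move=> aA aB E; apply: (atom_lift_inj aA aB (lifts aA)); rewrite E; exact: lifts.
have fint v : interior_vert c v -> interior_vert c (f v).
  case=> A [U [bA vA]]; have aA := boundary_atom bA; have [_ _ /(_ U bA) bB _] := lifts aA.
  exists (tgt A), (fV A @: U); split=> //.
  by rewrite (fA A) //; [apply: atom_lift_interior|case/setDP: vA].
have gint d : interior_dart c d -> interior_dart c (g d).
  case=> A [aA dA]; have [[_ _ _ gE _] aB _ _] := lifts aA.
  by exists (tgt A); rewrite (gA A) // -gE imset_f.
have fI : injective f.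
  move=> v1 v2 E.
  case: (classic (interior_vert c v1)) => [i1|/(old_vert R)[v1' E1]];
    case: (classic (interior_vert c v2)) => [i2|/(old_vert R)[v2' E2]].
  - case: i1 i2 => A [U [bA vA]] [B [W [bB vB]]].
    have aA := boundary_atom bA; have aB := boundary_atom bB.
    have vA1 : v1 \in A.1 by case/setDP: vA.
    have vB1 : v2 \in B.1 by case/setDP: vB.
    have [[fIA _ _ _ _] _ /(_ U bA) bA' _] := lifts aA.
    have [_ _ /(_ W bB) bB' _] := lifts aB.
    rewrite (fA A) // (fA B) // in E.
    have vA' := atom_lift_interior bA vA; have vB' := atom_lift_interior bB vB.
    rewrite -E in vB'.
    have EAB := tgt_inj A B aA aB
      (atoms_disjoint_vert Gconn (boundary_not_interior R) bA' bB' vA' vB').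
    by subst B; apply: fIA E.
  - by case: (@rv_not_interior _ _ R (q.1 v2')); rewrite -fR E2 -E; apply: fint.
  - by case: (@rv_not_interior _ _ R (q.1 v1')); rewrite -fR E1 E; apply: fint.
  by move: E; rewrite -E1 -E2 !fR => /rv_inj /perm_inj ->.
have gI : injective g.
  move=> d1 d2 E.
  case: (classic (interior_dart c d1)) => [i1|/(old_dart R)[d1' E1]];
    case: (classic (interior_dart c d2)) => [i2|/(old_dart R)[d2' E2]].
  - case: i1 i2 => A [aA dA] [B [aB dB]].
    have [[_ gIA _ gEA _] aA' _ _] := lifts aA; have [[_ _ _ gEB _] aB' _ _] := lifts aB.
    rewrite (gA A) // (gA B) // in E.
    have dA' : fD A d1 \in (tgt A).2 by rewrite -gEA imset_f.
    have dB' : fD A d1 \in (tgt B).2 by rewrite E -gEB imset_f.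
    have EAB := tgt_inj A B aA aB (disj aA' aB' dA' dB').
    by subst B; apply: gIA E.
  - by case: (interior_old_dart (gR _ _ E2)); rewrite -E; apply: gint.
  - by case: (interior_old_dart (gR _ _ E1)); rewrite E; apply: gint.
  have : q.2 d1' = q.2 d2'.
    by apply: (rd_inj (r := R)); rewrite (gR _ _ E1) (gR _ _ E2) E.
  by move/perm_inj=> Ed; move: E1; rewrite Ed E2 => -[].
exists (perm fI, perm gI); split.
  apply/autP => d; rewrite /preserves /= !permE.
  have omap_perm (o : option (vert G)) : omap (perm fI) o = omap f o.
    by case: o => //= v; rewrite permE.
  rewrite omap_perm.
  case: (classic (interior_dart c d)) => [[A [aA dA]]|/(old_dart R)[d' E]].
    (* The atom contains [inv d] and the end-vertex of [d], so one and the same lift governs all of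
       them. *)
    have [U bA] := atom_boundary aA; have [iA vA] := boundary_closed bA dA.
    have [[_ _ _ _ pr] _ _ _] := lifts aA; have := pr d dA; rewrite /preserves !(gA A) //.
    by case: (inc d) vA => [v /(_ v erefl) vA|_] //=; rewrite (fA A).
  have Eq := gR _ _ E; have := aq d'; case/and5P=> /eqP qi /eqP qv /eqP qc /eqP qk /implyP qp.
  have Ei : rd R (inv d') = inl (inv d) by apply: red_inv_old.
  apply/and5P; split.
  - have := red_inc R (q.2 d'); rewrite Eq qi => <-.
    have := red_inc R d'; rewrite E => <-.
    by case: (inc d') => //= v'; rewrite fR.
  - have := red_inv_old Eq; rewrite qv (gR _ _ Ei) => -[->]; exact: eqxx.
  - by rewrite -(red_color_old Eq) -(red_color_old E) qc.
  - by rewrite -(red_kind_old Eq) -(red_kind_old E) qk.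
  apply/implyP; rewrite -(red_pos_old Eq) -(red_pos_old E) -(red_kind_old E); exact: qp.
split=> [v'|d']; first by rewrite /= permE fR.
case E: (rd R d') => [d|[A o]]; first by rewrite /= permE; apply: gR.
have aA := rd_new_atom E; have [[_ _ EV ED _] _ _ lr] := lifts aA.
rewrite (lr _ _ E) /=; congr (inr (_, _)).
  rewrite [tgt A]surjective_pairing -EV -ED; congr pair; apply: eq_in_imset => t tA;
    by rewrite permE ?(fA A) ?(gA A).
case: o {lr} E => //= u E; have := rd_valid R d'; rewrite E => -[U bA uU].
by rewrite permE (fA A) // (boundary_sub Gconn bA).
Qed.

End Glue.

Lemma induced_surjective q : q \in AutG G' -> exists p, p \in AutG G /\ induced R p q.
Proof.
move=> aq.
have [t tP] : exists t : subgraph G -> subgraph G * (vert G -> vert G) * (dart G -> dart G),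
    forall A, atom c A -> atom_lift q A (t A).1.1 (t A).1.2 (t A).2.
  apply: (functional_choice (fun A s => atom c A -> atom_lift q A s.1.1 s.1.2 s.2)) => A.
  (* Off the atoms the implication is void and a default triple is returned. *)
  case: (classic (atom c A)) => [aA|nA]; last by exists (A, id, id).
  by have [B [f [g h]]] := atom_lift_exists aq aA; exists (B, f, g).
exact: (glue_exists aq (tgt := fun A => (t A).1.1) (fV := fun A => (t A).1.2) (fD := fun A => (t A).2) tP).
Qed.

(** A lift of [q] fixes the root of [G], and [red_root] reads membership in the new root off the old
    one. *)
Lemma reduced_root_fixed q : q \in AutG G' -> act_node q (Defs.root G') = Defs.root G'.
Proof.
move=> aq; have [p [ap [hv hd]]] := induced_surjective aq.
have := red_root R; have := fixc ap.
case: (Defs.root G) (Defs.root G') => [v|B] [v'|B'] //=.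
  by move=> [Ev] rE; congr inl; apply: (rv_inj (r := R)); rewrite hv rE.
move=> [EB] [hV hD]; congr inr.
have EV : p.1 @: B.1 = B.1 by rewrite -[RHS](congr1 fst EB).
have ED : p.2 @: B.2 = B.2 by rewrite -[RHS](congr1 snd EB).
have pV v : (p.1 v \in B.1) = (v \in B.1) by rewrite -{1}EV mem_imset //; apply: perm_inj.
have pD d : (p.2 d \in B.2) = (d \in B.2) by rewrite -{1}ED mem_imset //; apply: perm_inj.
have fixset (T : finType) (s : {perm T}) (X : {set T}) :
    (forall t, t \in X -> s t \in X) -> s @: X = X.
  move=> h; apply/eqP; rewrite eqEcard card_imset ?leqnn ?andbT; last exact: perm_inj.
  by apply/subsetP => _ /imsetP[t tX ->]; apply: h.
rewrite [RHS]surjective_pairing; congr pair; apply: fixset => t.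
  by move/hV => tB; apply/hV; rewrite hv pV.
move/hD => tB; apply/hD; rewrite hd.
case: (rd R t) tB => [d|[A o]] /=; first by rewrite pD.
(* A new edge belongs to the root block when its atom has a dart there; [p] carries this witness
   into the image atom. *)
by case=> d dA dB; exists (p.2 d); rewrite ?pD // imset_f.
Qed.

End Induced.

(** * Iteration along the series and the isomorphism theorem *)

Lemma series_invariant (G : graph) r (S : reduction_series G r) : connected (whole G) ->
  forall j, j <= r -> connected (whole (term S j)) /\
    (forall p, p \in AutG (term S j) -> act_node p (Defs.root (term S j)) = Defs.root (term S j)).
Proof.
move=> Gc; elim=> [_|j IH jr]; last first.
  have [cj fj] := IH (ltnW jr); split; first exact: reduced_connected (step S jr) cj.
  exact: reduced_root_fixed (step S jr) cj fj.
have cen := center0 S; have Gc0 : connected (whole (term S 0)) by rewrite (term0 S).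
by split=> // p ap; apply: act_center.
Qed.

Lemma reduction_epimorphism_exists (G G' : rooted_graph) (R : reduction G G') :
  connected (whole G) ->
  (forall p, p \in AutG G -> act_node p (Defs.root G) = Defs.root G) ->
  exists Phi : {morphism AutG G >-> ({perm vert G'} * {perm dart G'})%type},
    reduction_epimorphism R Phi.
Proof.
move=> Gc fixc.
have [f fP] : exists f : {perm vert G} * {perm dart G} -> {perm vert G'} * {perm dart G'},
    forall p, p \in AutG G -> f p \in AutG G' /\ induced R p (f p).
  apply: (functional_choice (fun p q => p \in AutG G -> q \in AutG G' /\ induced R p q)) => p.
  case: (boolP (p \in AutG G)) => [ap|]; last by exists 1%g.
  by have [q h] := induced_exists R Gc fixc ap; exists q.
(* Multiplicativity follows from uniqueness: the product of induced automorphisms is induced by the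
   product. *)
have fM : {in AutG G &, {morph f : p p' / (p * p')%g}}.
  move=> p p' ap ap'; apply: (induced_uniq (R := R) (p := (p * p')%g)).
    by case: (fP _ (groupM ap ap')).
  by apply: induced_mul; [case: (fP p ap)|case: (fP p' ap')].
exists (Morphism fM); split; first by move=> p /fP[].
apply/setP => q; apply/morphimP/idP => [[p _ ap ->]|aq]; first by case: (fP p ap).
have [p [ap I]] := induced_surjective R Gc aq; exists p => //.
by apply: induced_uniq I _; case: (fP p ap).
Qed.

Theorem proposition1p1 (G : graph)
    (hconn : connected (whole G))
    (hloop : loop_free G)
    (hhalf : half_edge_free G)
    (hpend : forall d : dart G, pendant d -> kind d = Undirected)
    (r : nat) (S : reduction_series G r)
    (i : nat) (hi : i < r) :
  exists Phi : {morphism AutG (term S i) >->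
      ({perm vert (term S i.+1)} * {perm dart (term S i.+1)})%type},
    reduction_epimorphism (step S hi) Phi /\
    (AutG (term S i.+1) \isog AutG (term S i) / 'ker Phi)%g.
Proof.
have [cj fj] := series_invariant S hconn (ltnW hi).
have [Phi PhiE] := reduction_epimorphism_exists (step S hi) cj fj.
exists Phi; split=> //; case: PhiE => _ <-.
by rewrite isog_sym; apply: first_isog.
Qed.
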